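(* Let $q$ satisfy condition $\mathbf{A}$ for $x\ge x_0$, and suppose $\rho(x)\to+\infty$ as $x\to+\infty$. Then for every $\lambda\notin\sigma(L_U)$ the resolvent $R_\lambda=(L_U-\lambda)^{-1}$ is a compact (completely continuous) operator on $L_2(\mathbb{R}_+)$.
   Context: $\mathbb{R}_+=[0,+\infty)$. Let $q\in L_{1,loc}(\mathbb{R}_+)$ be complex-valued and $l(y)=-y''+q(x)y$. The maximal domain is $D=\{y\in L_2(\mathbb{R}_+): y,y'\in AC_{loc}(\mathbb{R}_+),\ l(y)\in L_2(\mathbb{R}_+)\}$. For $\alpha_0,\alpha_1\in\mathbb{C}$ with $|\alpha_0|+|\alpha_1|\ne0$ put $U(y)=\alpha_0y(0)+\alpha_1y'(0)$, $D_U=\{y\in D: U(y)=0\}$, and $L_Uy=l(y)$ for $y\in D_U$. For $\kappa\ge 0$ let $\Pi_\kappa=\{z\in\mathbb{C}: z\neq 0,\ \arg z\in(-\pi+\kappa,\pi-\kappa)\}$. $q$ satisfies condition $\mathbf{A}$ for $x\ge x_0$ if: (i) $q\in L_{1,loc}(\mathbb{R}_+)$ and $q$ is locally absolutely continuous on $[x_0,+\infty)$; (ii) $q([x_0,+\infty))\subset\Pi_\kappa$ for some $\kappa\ge0$; (iii) there is $C>0$ with $\operatorname{Re}p(x)\ge C+\frac12|p'(x)/p(x)|$ for a.e. $x\ge x_0$, where $p=\sqrt{q}$ with $\operatorname{Re}p>0$ on $[x_0,\infty)$. For $x\ge x_0$ set $\rho(x)=\operatorname{Re}p(x)-\frac12\bigl|p'(x)/p(x)\bigr|$.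 *)

(* Defs.v *)
From HB Require Import structures.
From mathcomp Require Import all_boot all_order all_algebra.
From mathcomp Require Import all_classical all_reals all_analysis.
From mathcomp Require Import complex.

Set Implicit Arguments.
Unset Strict Implicit.
Unset Printing Implicit Defensive.
Import Order.TTheory GRing.Theory Num.Theory.
Import numFieldNormedType.Exports.

Local Open Scope classical_set_scope.
Local Open Scope ring_scope.

Section SturmLiouville.
Variable R : realType.
Local Notation C := R[i].
Local Notation mu := (@lebesgue_measure R).

Definition cRe (f : R -> C) : R -> R := fun x => complex.Re (f x).
Definition cIm (f : R -> C) : R -> R := fun x => complex.Im (f x).

Definition cabs (z : C) : R := Normc.normc z.

Definition Rplus : set R := [set x | 0 <= x].
Definition cc (a b : R) : set R := [set x | a <= x <= b].

Definition cintegrable (A : set R) (f : R -> C) : Prop :=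
  mu.-integrable A (EFin \o cRe f) /\ mu.-integrable A (EFin \o cIm f).

Definition cintegral (A : set R) (f : R -> C) : C :=
  Complex (\int[mu]_(x in A) cRe f x) (\int[mu]_(x in A) cIm f x).

Definition loc_int_from (a : R) (f : R -> C) : Prop :=
  forall b, a <= b -> cintegrable (cc a b) f.

(** y is locally absolutely continuous on [a, +oo), with derivative
    (the L_{1,loc} function) y1:  y(x) = y(a) + int_a^x y1. *)
Definition AC_loc_with (a : R) (y y1 : R -> C) : Prop :=
  loc_int_from a y1 /\ forall x, a <= x -> y x = y a + cintegral (cc a x) y1.

Definition L2 (f : R -> C) : Prop :=
  [/\ measurable_fun Rplus (cRe f), measurable_fun Rplus (cIm f) &
      (\int[mu]_(x in Rplus) ((cabs (f x)) ^+ 2)%:E < +oo)%E].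

Definition norm2 (f : R -> C) : R :=
  Num.sqrt (fine (\int[mu]_(x in Rplus) ((cabs (f x)) ^+ 2)%:E)%E).

Definition ae_on (A : set R) (P : R -> Prop) : Prop :=
  {ae mu, forall x, A x -> P x}.

(** the differential expression l(y) = -y'' + q y, where y2 = y'' *)
Definition lexpr (q y y2 : R -> C) : R -> C := fun x => - y2 x + q x * y x.

Definition in_D (q y y1 y2 : R -> C) : Prop :=
  [/\ AC_loc_with 0 y y1, AC_loc_with 0 y1 y2, L2 y & L2 (lexpr q y y2)].

Definition in_DU (a0 a1 : C) (q y y1 y2 : R -> C) : Prop :=
  in_D q y y1 y2 /\ a0 * y 0 + a1 * y1 0 = 0.

Definition shifted (q : R -> C) (lam : C) (y y2 : R -> C) : R -> C :=
  fun x => lexpr q y y2 x - lam * y x.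

(** lambda is in the resolvent set of L_U (i.e. lambda \notin sigma(L_U)):
    L_U - lambda : D_U -> L_2(R_+) is bijective (elements of L_2 being
    identified when equal a.e.) and its inverse is bounded. *)
Definition in_resolvent_set (a0 a1 : C) (q : R -> C) (lam : C) : Prop :=
  [/\ (forall f, L2 f -> exists y y1 y2,
          in_DU a0 a1 q y y1 y2 /\ ae_on Rplus (fun x => shifted q lam y y2 x = f x)),
      (forall y y1 y2, in_DU a0 a1 q y y1 y2 ->
          ae_on Rplus (fun x => shifted q lam y y2 x = 0) ->
          ae_on Rplus (fun x => y x = 0)) &
      exists M : R, forall y y1 y2, in_DU a0 a1 q y y1 y2 ->
          norm2 y <= M * norm2 (shifted q lam y y2)].

Definition resolvent_compact (a0 a1 : C) (q : R -> C) (lam : C) : Prop :=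
  forall (f y y1 y2 : nat -> R -> C) (M : R),
    (forall n, L2 (f n) /\ norm2 (f n) <= M) ->
    (forall n, in_DU a0 a1 q (y n) (y1 n) (y2 n) /\
               ae_on Rplus (fun x => shifted q lam (y n) (y2 n) x = f n x)) ->
    exists (phi : nat -> nat) (g : R -> C),
      [/\ (forall n m, (n < m)%N -> (phi n < phi m)%N), L2 g &
          (fun n => norm2 (fun x => y (phi n) x - g x)) @ \oo --> (0 : R)].

Definition in_Pi (kappa : R) (z : C) : Prop :=
  exists r theta : R, [/\ 0 < r, - pi + kappa < theta < pi - kappa &
                         z = Complex (r * cos theta) (r * sin theta)].

Definition is_sqrt_branch (q p : R -> C) (x0 : R) : Prop :=
  forall x, x0 <= x -> p x ^+ 2 = q x /\ 0 < complex.Re (p x).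

(** condition A for x >= x0 (p = sqrt q with Re p > 0, p1 = p') *)
Definition condA (q : R -> C) (x0 : R) (p p1 : R -> C) : Prop :=
  [/\ loc_int_from 0 q /\ (exists q1, AC_loc_with x0 q q1),
      exists kappa : R, 0 <= kappa /\ forall x, x0 <= x -> in_Pi kappa (q x) &
      exists c : R, 0 < c /\
        ae_on [set x | x0 <= x]
          (fun x => c + 2^-1 * cabs (p1 x / p x) <= complex.Re (p x))].

Definition rho (p p1 : R -> C) (x : R) : R :=
  complex.Re (p x) - 2^-1 * cabs (p1 x / p x).

(** rho(x) -> +oo as x -> +oo (rho being defined a.e.) *)
Definition rho_to_infty (x0 : R) (p p1 : R -> C) : Prop :=
  forall M : R, exists X : R, x0 <= X /\
    ae_on [set x | X <= x] (fun x => M <= rho p p1 x).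

End SturmLiouville.

(* Main.v *)
Require Import Defs.
From HB Require Import structures.
From mathcomp Require Import all_boot all_order all_algebra.
From mathcomp Require Import all_classical all_reals all_analysis measurable_realfun.
From mathcomp Require Import complex ring lra.
Import Order.TTheory GRing.Theory Num.Theory.
Import numFieldNormedType.Exports.
Local Open Scope classical_set_scope.
Local Open Scope ring_scope.

(** Write [l(y) = g] with [q = p^2].  The derivative of [E = Re (y' conj(y) / p)]
    is [Re p |y|^2 + Re (1/p) |y'|^2 - Re (g conj(y) / p) - Re (y' conj(y) p' / p^2)],
    which is at least [rho (|y|^2 + |y'/p|^2) - |g| |y| / |p|].  Integrating
    [(chi^2 E)'] for a trapezoidal cutoff [chi] gives
    [\int_X^N |y|^2 <= C (|y|^2 + |g|^2) / inf_(x >= X) rho] in the L2 norms: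
    the tails of the solutions are uniformly small.  On a compact interval
    [y] and [y'] are bounded in terms of the same norms, so that the solutions
    are equi-Lipschitz there; a limit along a nonprincipal ultrafilter on nat is
    then locally uniform, and the tail estimate upgrades it to an L2 limit. *)

Set Implicit Arguments.
Unset Strict Implicit.
Unset Printing Implicit Defensive.

(** * Integration and absolute continuity on intervals *)

Section IntervalIntegral.
Variable R : realType.
Local Notation mu := (@lebesgue_measure R).
Implicit Types (a b c d : R) (f g F G : R -> R).

(** The half in [rho] comes from the cross term of the energy: [Re (1/p) |y'|^2] equals
    [Re p |y'/p|^2], while [|y' conj(y) p'/p^2|] is at most [|p'/p| |y| |y'/p|], and the
    arithmetic-geometric mean puts half of [|p'/p|] on each of [|y|^2] and [|y'/p|^2]. The obstacle
    is that [y'/p] has no a priori L2 bound, so the cutoff must not leave behind an unweighted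
    [|y'/p|^2]; squaring the cutoff keeps a factor [chi] in the term [2 chi chi' E], which can then
    be absorbed by the main term. The spectral parameter is moved to the right side,
    [g = f + lam y], where boundedness of the inverse controls its norm; the boundary condition
    enters through that bound. Derivatives are densities of integrals throughout, so the product and
    quotient rules behind the derivative of [E] are proved at the level of integrals, and
    [quadratic_increment] is the tool for this. *)

Definition iint a b f : Prop := mu.-integrable `[a, b] (EFin \o f).
Definition intg a b f : R := \int[mu]_(x in `[a, b]) f x.

Lemma ccE a b : cc a b = `[a, b]%classic.
Proof. by rewrite set_itvcc. Qed.

Lemma mitv a b : measurable (`[a, b]%classic : set (measurableTypeR R)).
Proof. exact: measurable_itv. Qed.

Lemma iintS a b c d f : a <= c -> d <= b -> iint a b f -> iint c d f.
Proof.
move=> ac db; apply: integrableS; try exact: mitv.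
by apply: subset_itv; rewrite bnd_simp.
Qed.

Lemma iint_eq a b f g : (forall x, a <= x <= b -> f x = g x) -> iint a b f -> iint a b g.
Proof.
move=> fg; apply: eq_integrable; first exact: mitv.
by move=> x; rewrite inE /= in_itv => xab /=; rewrite fg.
Qed.

Lemma iintD a b f g : iint a b f -> iint a b g -> iint a b (fun x => f x + g x).
Proof. by move=> fi gi; apply: (integrableD _ fi gi); exact: mitv. Qed.

Lemma iintB a b f g : iint a b f -> iint a b g -> iint a b (fun x => f x - g x).
Proof. by move=> fi gi; apply: (integrableB _ fi gi); exact: mitv. Qed.

Lemma iintZ a b k f : iint a b f -> iint a b (fun x => k * f x).
Proof. by move=> fi; apply: (integrableZl _ k fi); exact: mitv. Qed.

Lemma iint_norm a b f : iint a b f -> iint a b (fun x => `|f x|).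
Proof. by move=> fi; exact: (integrable_abse fi). Qed.

Lemma iint_cont a b f : {within `[a, b], continuous f} -> iint a b f.
Proof.
move=> cf; apply: continuous_compact_integrable cf; exact: segment_compact.
Qed.

Lemma iint_cst a b k : iint a b (fun=> k).
Proof. by apply: iint_cont => x; exact: cst_continuous. Qed.

Lemma cont_bounded a b F : {within `[a, b], continuous F} ->
  exists2 C, 0 <= C & forall x, a <= x <= b -> `|F x| <= C.
Proof.
move=> cF; have [ab|ba] := leP a b; last first.
  exists 0 => // x /andP[ax xb]; by have := le_trans ax xb; rewrite leNgt ba.
have [c _ cM] := EVT_max ab cF; have [e _ eM] := EVT_min ab cF.
exists (`|F c| + `|F e|); first by rewrite addr_ge0.
move=> x xab; have := cM x; have := eM x; rewrite in_itv /= xab.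
move=> /(_ isT) h1 /(_ isT) h2; rewrite ler_norml.
have := ler_norm (F c); have := ler_norm (- F e); rewrite normrN.
have := normr_ge0 (F c); have := normr_ge0 (F e); lra.
Qed.

Lemma iintM a b f G : iint a b f -> {within `[a, b], continuous G} ->
  iint a b (fun x => f x * G x).
Proof.
move=> fi cG; apply: (@integrableMl _ _ _ mu `[a, b] _ (EFin \o f) G) => //.
  by apply: subspace_continuous_measurable_fun => //; exact: mitv.
have [C C0 hC] := cont_bounded cG.
exists C; split; first by rewrite num_real.
by move=> k Ck x /=; rewrite in_itv /= => xab; rewrite (le_trans (hC x xab)) // ltW.
Qed.

Lemma intgD a b f g : iint a b f -> iint a b g ->
  intg a b (fun x => f x + g x) = intg a b f + intg a b g.
Proof. by move=> fi gi; rewrite /intg RintegralD //; exact: mitv. Qed.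

Lemma intgB a b f g : iint a b f -> iint a b g ->
  intg a b (fun x => f x - g x) = intg a b f - intg a b g.
Proof. by move=> fi gi; rewrite /intg RintegralB //; exact: mitv. Qed.

Lemma intgZ a b k f : iint a b f -> intg a b (fun x => k * f x) = k * intg a b f.
Proof. by move=> fi; rewrite /intg RintegralZl //; exact: mitv. Qed.

Lemma intg_cst a b k : a <= b -> intg a b (fun=> k) = k * (b - a).
Proof.
move=> ab; rewrite /intg Rintegral_cst; last exact: mitv.
have E : fine (@lebesgue_measure R `[a, b]%classic) = b - a.
  rewrite lebesgue_measure_itv /= lte_fin; case: ltP => //= ba.
  by rewrite (le_anti (introT andP (conj ab ba))) subrr.
by congr (_ * _); exact: E.
Qed.

Lemma intg_eq a b f g : (forall x, a <= x <= b -> f x = g x) -> intg a b f = intg a b g.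
Proof. by move=> fg; apply: eq_Rintegral => x; rewrite inE /= in_itv => /fg. Qed.

Lemma intg_le a b f g : iint a b f -> iint a b g ->
  (forall x, a <= x <= b -> f x <= g x) -> intg a b f <= intg a b g.
Proof.
by move=> fi gi fg; apply: le_Rintegral.
Qed.

Lemma intg_ge0 a b f : (forall x, a <= x <= b -> 0 <= f x) -> 0 <= intg a b f.
Proof. by move=> f0; apply: Rintegral_ge0 => x /=; rewrite in_itv; exact: f0. Qed.

Lemma intg_norm a b f : iint a b f -> `|intg a b f| <= intg a b (fun x => `|f x|).
Proof. by move=> fi; apply: le_normr_Rintegral => //; exact: mitv. Qed.

Lemma intg_split a c b f : a <= c <= b -> iint a b f ->
  intg a b f = intg a c f + intg c b f.
Proof.
move=> /andP[ac cb] fi; have := @Rintegral_itvB R f (BLeft a) (BRight b) c fi.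
rewrite !bnd_simp => /(_ ac cb); rewrite Rintegral_itv_obnd_cbnd; last first.
  apply: integrableS fi => //.
  by apply: subset_itv; rewrite ?bnd_simp.
by rewrite /intg => <-; rewrite addrC subrK.
Qed.

Lemma ae_imp (P Q : R -> Prop) : (forall x, P x -> Q x) ->
  {ae mu, forall x, P x} -> {ae mu, forall x, Q x}.
Proof. by move=> PQ; apply: (@filterS _ _ (ae_filter_ringOfSetsType mu)). Qed.

Lemma intg_ae_ge0 a b f : iint a b f ->
  {ae mu, forall x, a <= x <= b -> 0 <= f x} -> 0 <= intg a b f.
Proof.
move=> fi f0; have fm := measurable_int _ fi.
have <- : intg a b (fun x => `|f x|) = intg a b f; last first.
  by apply: intg_ge0 => x _; exact: normr_ge0.
congr fine; apply: ae_eq_integral; first exact: mitv.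
- exact: (measurable_int _ (iint_norm fi)).
- exact: fm.
- apply: ae_imp f0 => x fx xab; congr EFin; rewrite ger0_norm //.
  by apply: fx; move: xab; rewrite /= in_itv.
Qed.

Lemma intg_ae_le a b f g : iint a b f -> iint a b g ->
  {ae mu, forall x, a <= x <= b -> f x <= g x} -> intg a b f <= intg a b g.
Proof.
move=> fi gi fg; rewrite -subr_ge0 -intgB //; apply: intg_ae_ge0; first exact: iintB.
by apply: ae_imp fg => x h /h; rewrite subr_ge0.
Qed.

Lemma intgaa a f : intg a a f = 0.
Proof. by rewrite /intg set_itv1 Rintegral_set1. Qed.

Lemma intg_cont a b f : iint a b f -> {within `[a, b], continuous (intg a ^~ f)}.
Proof.
move=> fi; have [ab|ba] := leP a b; first exact: parameterized_integral_continuous.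
by rewrite set_itv_ge ?bnd_simp -?ltNge //; exact: continuous_subspace0.
Qed.

(* By the intermediate value theorem [s, t] can be cut where V takes its mean
   value, which halves the bound; iterate. *)
Lemma quadratic_increment a b (K : R) (H V : R -> R) : a <= b ->
  {within `[a, b], continuous V} ->
  (forall s t, a <= s -> s <= t -> t <= b ->
     `|H t - H s| <= K * (V t - V s) ^+ 2) -> H a = H b.
Proof.
move=> ab cV hH.
have step n : forall s t, a <= s -> s <= t -> t <= b ->
    `|H t - H s| <= K * (V t - V s) ^+ 2 / 2 ^+ n.
  elim: n => [|n IH] s t as_ st tb; first by rewrite expr0 divr1 hH.
  have cVst : {within `[s, t], continuous V}.
    by apply: continuous_subspaceW cV; apply: subset_itv; rewrite bnd_simp.
  have [|m mst Vm] := @IVT R V s t ((V s + V t) / 2) st cVst.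
    rewrite /Num.min /Num.max; case: ltP => ?; lra.
  move: mst; rewrite in_itv /= => /andP[sm mt].
  have h1 := IH s m as_ sm (le_trans mt tb).
  have h2 := IH m t (le_trans as_ sm) mt tb.
  have -> : H t - H s = (H t - H m) + (H m - H s) by ring.
  apply: (le_trans (ler_normD _ _)); apply: (le_trans (lerD h2 h1)).
  rewrite Vm (exprS 2 n) le_eqVlt; apply/orP; left; apply/eqP; field.
  by rewrite expf_neq0.
set C := K * (V b - V a) ^+ 2 in step.
have bnd n : `|H b - H a| <= C / 2 ^+ n by exact: step.
apply/eqP; rewrite eq_sym -subr_eq0 -normr_le0; apply/ler_addgt0Pl => e e0.
rewrite addr0; set n := Num.bound `|C / e|.
apply: (le_trans (bnd n)); rewrite ler_pdivrMr ?exprn_gt0 // -ler_pdivrMl //.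
rewrite mulrC; apply: (le_trans (ler_norm _)); apply: ltW.
have Ce : `|C / e| < n%:R by exact: archi_boundP (normr_ge0 _).
apply: (lt_le_trans Ce); rewrite -natrX ler_nat ltnW //; exact: ltn_expl.
Qed.

(** The density [f] plays the role of [F'] without any appeal to differentiability almost
    everywhere, so every calculus rule has to exhibit the density of its result. *)
Definition ac a b F f : Prop :=
  iint a b f /\ forall x, a <= x <= b -> F x = F a + intg a x f.

Lemma ac_sub a b F f s t : ac a b F f -> a <= s -> s <= t -> t <= b ->
  F t - F s = intg s t f.
Proof.
move=> [fi hF] as_ st tb.
have fit : iint a t f by exact: iintS fi.
rewrite (hF t) ?(le_trans as_ st) // (hF s) ?as_ ?(le_trans st tb) //.
by rewrite (@intg_split a s t) ?as_ //; ring.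
Qed.

Lemma acS a b c d F f : a <= c -> d <= b -> ac a b F f -> ac c d F f.
Proof.
move=> ac_ db h; split; first exact: iintS h.1.
move=> x /andP[cx xd]; rewrite -(ac_sub h) //; first by ring.
exact: le_trans db.
Qed.

Lemma ac_cont a b F f : ac a b F f -> {within `[a, b], continuous F}.
Proof.
move=> [fi hF].
have := @intg_cont a b f fi.
have h : {in `[a, b]%classic, (fun x => F a + intg a x f) =1 F}.
  by move=> x; rewrite ?inE /= ?in_itv /= => /hF.
move=> ci; apply: (subspace_eq_continuous h).
by apply: within_continuousD ci => x; exact: cst_continuous.
Qed.

Lemma ac_eq a b F f g : (forall x, a <= x <= b -> f x = g x) ->
  ac a b F f -> ac a b F g.
Proof.
move=> fg [fi hF]; split; first exact: iint_eq fi.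
move=> x xab; rewrite hF //; congr (_ + _); apply: intg_eq => u /andP[au ux].
by apply: fg; rewrite au (le_trans ux) //; case/andP: xab.
Qed.

Lemma acD a b F f G g : ac a b F f -> ac a b G g ->
  ac a b (fun x => F x + G x) (fun x => f x + g x).
Proof.
move=> [fi hF] [gi hG]; split; first exact: iintD.
move=> x xab; rewrite hF // hG // intgD; first by ring.
- by apply: iintS fi => //; case/andP: xab.
- by apply: iintS gi => //; case/andP: xab.
Qed.

Lemma acB a b F f G g : ac a b F f -> ac a b G g ->
  ac a b (fun x => F x - G x) (fun x => f x - g x).
Proof.
move=> [fi hF] [gi hG]; split; first exact: iintB.
move=> x xab; rewrite hF // hG // intgB; first by ring.
- by apply: iintS fi => //; case/andP: xab.
- by apply: iintS gi => //; case/andP: xab.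
Qed.

Lemma ac_affine a b k m : ac a b (fun x => k * x + m) (fun=> k).
Proof.
split; first exact: iint_cst.
by move=> x /andP[ax _]; rewrite intg_cst //; ring.
Qed.

(** An error of second order in [intg s t v] is harmless: the defect [F t - intg a t f] then
    satisfies [quadratic_increment] with the continuous primitive of [v], hence is constant. The
    function [v] need only be integrable, not bounded. *)
Lemma ac_intro a b (K : R) F f (v : R -> R) : a <= b -> iint a b f -> iint a b v ->
  (forall s t, a <= s -> s <= t -> t <= b ->
     `|F t - F s - intg s t f| <= K * (intg s t v) ^+ 2) -> ac a b F f.
Proof.
move=> ab fi vi h; split=> // x /andP[ax xb].
pose H t := F t - intg a t f.
suff: H a = H x.
  by rewrite /H intgaa; move=> /eqP; rewrite subr0 eq_sym subr_eq => /eqP ->.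
have vx : iint a x v by exact: iintS vi.
have fx : iint a x f by exact: iintS fi.
apply: (@quadratic_increment a x K H (intg a ^~ v)) => //.
  exact: intg_cont.
move=> s t as_ st tx.
have -> : H t - H s = F t - F s - intg s t f.
  rewrite /H (@intg_split a s t f) ?as_ //; first by ring.
  exact: iintS fx.
have -> : intg a t v - intg a s v = intg s t v.
  rewrite (@intg_split a s t v) ?as_ //; first by ring.
  exact: iintS vx.
by apply: h => //; exact: le_trans xb.
Qed.

Lemma intg_norm_le a b f g : iint a b f -> iint a b g ->
  (forall x, a <= x <= b -> `|f x| <= g x) -> `|intg a b f| <= intg a b g.
Proof.
move=> fi gi fg; apply: (le_trans (intg_norm fi)).
by apply: intg_le => //; exact: iint_norm.
Qed.

Lemma intg_mono a b c d f : a <= c -> c <= d -> d <= b -> iint a b f ->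
  (forall x, a <= x <= b -> 0 <= f x) -> intg c d f <= intg a b f.
Proof.
move=> ac_ cd db fi f0.
rewrite (@intg_split a c b) ?ac_ ?(le_trans cd) // (@intg_split c d b) ?cd //; last first.
  exact: iintS fi.
have h1 : 0 <= intg a c f.
  by apply: intg_ge0 => x /andP[ax xc]; apply: f0; rewrite ax (le_trans xc) // (le_trans cd).
have h2 : 0 <= intg d b f.
  by apply: intg_ge0 => x /andP[dx xb]; apply: f0; rewrite xb (le_trans _ dx) // (le_trans ac_).
lra.
Qed.

(** The defect over [[s, t]] is the integral of [f x * (G t - G x) - g x * (F x - F s)]. Each
    increment is at most [V], the integral of [|f| + |g|], so the defect is at most [V ^+ 2]. *)
Lemma ac_mul a b F f G g : a <= b -> ac a b F f -> ac a b G g ->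
  ac a b (fun x => F x * G x) (fun x => f x * G x + g x * F x).
Proof.
move=> ab hF hG; have cF := ac_cont hF; have cG := ac_cont hG.
have fi := hF.1; have gi := hG.1.
have fGi : iint a b (fun x => f x * G x) by exact: iintM.
have gFi : iint a b (fun x => g x * F x) by exact: iintM.
apply: (@ac_intro a b 1 _ _ (fun x => `|f x| + `|g x|)) => //.
- exact: iintD.
- by apply: iintD; exact: iint_norm.
move=> s t as_ st tb; rewrite mul1r.
have S h : iint a b h -> iint s t h by exact: iintS.
set V := intg s t (fun x => `|f x| + `|g x|).
have Ff : forall u w, s <= u -> u <= w -> w <= t -> `|F w - F u| <= V.
  move=> u w su uw wt; rewrite (ac_sub hF) ?(le_trans as_) ?(le_trans wt) //.
  have fuw : iint u w f by apply: iintS (S _ fi).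
  apply: (le_trans (intg_norm fuw)).
  apply: (@le_trans _ _ (intg s t (fun x => `|f x|))).
    by apply: intg_mono => //; exact: iint_norm (S _ fi).
  apply: intg_le => [||x _]; last by rewrite /= lerDl.
    exact: iint_norm (S _ fi).
  by apply: iintD; apply: iint_norm; exact: S.
have Gg : forall u w, s <= u -> u <= w -> w <= t -> `|G w - G u| <= V.
  move=> u w su uw wt; rewrite (ac_sub hG) ?(le_trans as_) ?(le_trans wt) //.
  have guw : iint u w g by apply: iintS (S _ gi).
  apply: (le_trans (intg_norm guw)).
  apply: (@le_trans _ _ (intg s t (fun x => `|g x|))).
    by apply: intg_mono => //; exact: iint_norm (S _ gi).
  apply: intg_le => [||x _]; last by rewrite /= lerDr.
    exact: iint_norm (S _ gi).
  by apply: iintD; apply: iint_norm; exact: S.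
have e1 : F t * G t - F s * G s = G t * intg s t f + F s * intg s t g.
  by rewrite -(ac_sub hF) // -(ac_sub hG) //; ring.
have -> : F t * G t - F s * G s - intg s t (fun x => f x * G x + g x * F x) =
    intg s t (fun x => (G t * f x + F s * g x) - (f x * G x + g x * F x)).
  rewrite intgB ?intgD ?intgZ; try by [exact: S | apply: iintZ; exact: S].
  - by rewrite e1.
  - by apply: iintD; apply: iintZ; exact: S.
  - by apply: iintD; exact: S.
rewrite expr2 -[X in _ <= V * X]/(intg _ _ _) -intgZ; last first.
  by apply: iintD; apply: iint_norm; exact: S.
apply: intg_norm_le.
- apply: iintB; apply: iintD; try apply: iintZ; exact: S.
- by apply: iintZ; apply: iintD; apply: iint_norm; exact: S.
move=> x /andP[sx xt].
have -> : G t * f x + F s * g x - (f x * G x + g x * F x) =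
  f x * (G t - G x) - g x * (F x - F s) by ring.
apply: (le_trans (ler_normB _ _)); rewrite !normrM mulrDr ![V * _]mulrC.
by apply: lerD; apply: ler_wpM2l => //; [apply: Gg | apply: Ff].
Qed.

Lemma cont_inv a b F : {within `[a, b], continuous F} ->
  (forall x, a <= x <= b -> 0 < F x) ->
  {within `[a, b], continuous (fun x => (F x)^-1)}.
Proof.
move=> cF F0; apply: (@within_continuous_comp _ _ _ _ F (@GRing.inv R)) => //.
move=> _ /set_mem [x xab <-]; apply: inv_continuous.
by rewrite gt_eqF //; apply: F0; move: xab; rewrite /= in_itv.
Qed.

Lemma cont_mul a b F G : {within `[a, b], continuous F} ->
  {within `[a, b], continuous G} -> {within `[a, b], continuous (fun x => F x * G x)}.
Proof. by move=> cF cG x; apply: cvgM; [exact: cF | exact: cG]. Qed.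

(** With [r = 1/F] bounded by [C], increments of [r] are at most [C ^+ 2 * V], and the density of
    the defect is [f] times two products of a value and an increment of [r]; this yields the
    constant [2 * C ^+ 3]. *)
Lemma ac_inv a b F f : a <= b -> ac a b F f ->
  (forall x, a <= x <= b -> 0 < F x) ->
  ac a b (fun x => (F x)^-1) (fun x => - f x * (F x)^-1 ^+ 2).
Proof.
move=> ab hF F0; have fi := hF.1; have cr := cont_inv (ac_cont hF) F0.
have [C C0 hC] := cont_bounded cr.
have nfi : iint a b (fun x => - f x).
  by apply: iint_eq (iintZ (-1) fi) => x _; rewrite mulN1r.
have c2 := cont_mul cr cr.
apply: (@ac_intro a b (2 * C ^+ 3) _ _ (fun x => `|f x|)) => //.
- by apply: iintM.
- exact: iint_norm.
move=> s t as_ st tb.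
set r := fun x => (F x)^-1 in cr hC c2 *.
have inab u : s <= u -> u <= t -> a <= u <= b.
  by move=> su ut; rewrite (le_trans as_ su) (le_trans ut tb).
have S h : iint a b h -> iint s t h by exact: iintS.
set V := intg s t (fun x => `|f x|).
have rr : forall u w, s <= u -> u <= w -> w <= t -> `|r w - r u| <= C ^+ 2 * V.
  move=> u w su uw wt.
  have Fu : F u != 0 by rewrite gt_eqF // F0 // inab // (le_trans uw).
  have Fw : F w != 0 by rewrite gt_eqF // F0 // inab // (le_trans su).
  have -> : r w - r u = - ((F w - F u) * (r w * r u)) by rewrite /r; field; rewrite Fu Fw.
  rewrite normrN normrM mulrC; apply: ler_pM => //.
    by rewrite normrM expr2; apply: ler_pM => //; apply: hC; rewrite inab //
       ?(le_trans su) // (le_trans uw).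
  rewrite (ac_sub hF) ?(le_trans as_) ?(le_trans wt) //.
  have fuw : iint u w f by apply: iintS (S _ fi).
  apply: (le_trans (intg_norm fuw)).
  by apply: intg_mono => //; exact: iint_norm (S _ fi).
have Fs : F s != 0 by rewrite gt_eqF // F0 // inab.
have Ft : F t != 0 by rewrite gt_eqF // F0 // inab.
have e1 : r t - r s = - (r s * r t) * intg s t f.
  by rewrite -(ac_sub hF) // /r; field; rewrite Fs Ft.
rewrite e1 -intgZ; last exact: S.
rewrite -intgB; first last.
- by apply: S; exact: iintM.
- by apply: iintZ; exact: S.
rewrite expr2 mulrA -intgZ; last by apply: iint_norm; exact: S.
apply: intg_norm_le.
- apply: iintB; first by apply: iintZ; exact: S.
  by apply: S; exact: iintM.
- by apply: iintZ; apply: iint_norm; exact: S.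
move=> x /andP[sx xt].
have -> : - (r s * r t) * f x - - f x * r x ^+ 2 =
  (r x * (r x - r s) - r s * (r t - r x)) * f x by ring.
rewrite normrM ler_wpM2r //; apply: (le_trans (ler_normB _ _)).
have -> : 2 * C ^+ 3 * V = C * (C ^+ 2 * V) + C * (C ^+ 2 * V) by ring.
by rewrite !normrM; apply: lerD; apply: ler_pM => //; [apply: hC; rewrite inab|
  apply: rr|apply: hC; rewrite inab|apply: rr].
Qed.

End IntervalIntegral.

(** * The energy estimate *)

Section Energy.
Variable R : realType.
Local Notation mu := (@lebesgue_measure R).

Lemma norm_le_of_sqr (a b : R) : 0 <= b -> a ^+ 2 <= b ^+ 2 -> `|a| <= b.
Proof.
move=> b0 ab; rewrite -(@ler_pXn2r _ 2) ?nnegrE //.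
by rewrite real_normK ?num_real.
Qed.

(** The right side is the derivative of [chi^2 E], with [k] for [chi'], [tau] for [|p'/p|], [N / D]
    for [E], and the equation substituted for [y''] in [N']. Since [Re p >= 1], also [1/|p| <= 1].
    The constants [1/2] and [3/2] collect [|g| |y| <= (|g|^2 + |y|^2) / 2] and one more [|y|^2]
    caused by the cutoff. *)
Lemma energy_pointwise (u v u1 v1 gu gv pa pb pa1 pb1 tau M chi k : R) :
  let D := pa ^+ 2 + pb ^+ 2 in
  let u2 := (pa ^+ 2 - pb ^+ 2) * u - 2 * pa * pb * v - gu in
  let v2 := (pa ^+ 2 - pb ^+ 2) * v + 2 * pa * pb * u - gv in
  let N := (u1 * u + v1 * v) * pa + (v1 * u - u1 * v) * pb in
  let N' := (u2 * u + v2 * v + u1 ^+ 2 + v1 ^+ 2) * pa + (u1 * u + v1 * v) * pa1 +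
            (v2 * u - u2 * v) * pb + (v1 * u - u1 * v) * pb1 in
  1 <= M -> 0 <= tau -> tau ^+ 2 * D = pa1 ^+ 2 + pb1 ^+ 2 ->
  M + 2^-1 * tau <= pa -> 0 <= chi -> chi <= 1 -> `|k| <= 1 ->
  (M - 1) * (chi ^+ 2 * (u ^+ 2 + v ^+ 2)) -
    (2^-1 * (gu ^+ 2 + gv ^+ 2) + 3 / 2 * (u ^+ 2 + v ^+ 2)) <=
  2 * chi * k * (N / D) +
    chi ^+ 2 * (N' / D - N * (2 * (pa * pa1 + pb * pb1)) / D ^+ 2).
Proof.
move=> D u2 v2 N N' M1 tau0 htau hM c0 c1 k1.
have pa1_ : 1 <= pa by have : 0 <= 2^-1 * tau; [rewrite mulr_ge0 | lra].
have D1 : 1 <= D.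
  by rewrite /D; have := sqr_ge0 pb; have : 0 <= (pa - 1) * (pa + 1);
    [rewrite mulr_ge0; lra | rewrite -subr_sqr; lra].
have D0 : D != 0 by lra.
set Y := u ^+ 2 + v ^+ 2; set S := u1 ^+ 2 + v1 ^+ 2; set g2 := gu ^+ 2 + gv ^+ 2.
have Y0 : 0 <= Y by rewrite addr_ge0 ?sqr_ge0.
have S0 : 0 <= S by rewrite addr_ge0 ?sqr_ge0.
have g0 : 0 <= g2 by rewrite addr_ge0 ?sqr_ge0.
set Z := S / D.
have Z0 : 0 <= Z by rewrite divr_ge0 //; lra.
have di1 : 0 <= D^-1 <= 1 by rewrite invr_ge0 invf_le1; lra.
(* [G] is [Re (g conj(y) / p)], [ca + i cb] is [p'/p^2], and [P] is [Re (y' conj(y) p'/p^2)]. With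
   [Y = |y|^2] and [Z = |y'/p|^2], the derivative of the energy becomes [Re p (Y + Z) - G - P]. *)
pose G := ((gu * u + gv * v) * pa + (gv * u - gu * v) * pb) / D.
pose ca := (pa1 * (pa ^+ 2 - pb ^+ 2) + 2 * pb1 * pa * pb) / D ^+ 2.
pose cb := (pb1 * (pa ^+ 2 - pb ^+ 2) - 2 * pa1 * pa * pb) / D ^+ 2.
pose P := (u1 * u + v1 * v) * ca - (v1 * u - u1 * v) * cb.
have hE' : N' / D - N * (2 * (pa * pa1 + pb * pb1)) / D ^+ 2 = pa * (Y + Z) - G - P.
  by rewrite /G /P /ca /cb /Z /S /Y /N' /N /u2 /v2; move: D0; rewrite /D => D0; field.
(* Cauchy-Schwarz in the plane from Lagrange's identity; the bounds drawn from it are kept in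
   squared form, which avoids square roots of [Y] and [Z]. *)
have cs (a b c d : R) : (a * c + b * d) ^+ 2 <= (a ^+ 2 + b ^+ 2) * (c ^+ 2 + d ^+ 2).
  rewrite -subr_ge0.
  have -> : (a ^+ 2 + b ^+ 2) * (c ^+ 2 + d ^+ 2) - (a * c + b * d) ^+ 2 =
    (a * d - b * c) ^+ 2 by ring.
  exact: sqr_ge0.
have hN2 : (N / D) ^+ 2 <= Y * Z.
  have -> : Y * Z = ((u1 * u + v1 * v) ^+ 2 + (v1 * u - u1 * v) ^+ 2) * D / D ^+ 2.
    by rewrite /Z /Y /S; field.
  by rewrite expr_div_n; apply: ler_wpM2r; [rewrite invr_ge0 sqr_ge0 | exact: cs].
have hG2 : G ^+ 2 <= g2 * Y.
  apply: (@le_trans _ _ (g2 * Y * D^-1)); last first.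
    by rewrite ler_piMr ?mulr_ge0 //; case/andP: di1.
  have -> : g2 * Y * D^-1 = ((gu * u + gv * v) ^+ 2 + (gv * u - gu * v) ^+ 2) * D / D ^+ 2.
    by rewrite /g2 /Y; field.
  by rewrite expr_div_n; apply: ler_wpM2r; [rewrite invr_ge0 sqr_ge0 | exact: cs].
have hP2 : P ^+ 2 <= tau ^+ 2 * (Y * Z).
  have -> : tau ^+ 2 * (Y * Z) =
      ((u1 * u + v1 * v) ^+ 2 + (v1 * u - u1 * v) ^+ 2) * (ca ^+ 2 + (- cb) ^+ 2).
    have -> : tau ^+ 2 = (pa1 ^+ 2 + pb1 ^+ 2) / D by rewrite -htau; field.
    by rewrite /Z /Y /S /ca /cb; move: D0; rewrite /D => D0; field.
  have -> : P = (u1 * u + v1 * v) * ca + (v1 * u - u1 * v) * (- cb) by rewrite /P; ring.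
  exact: cs.
(* The arithmetic-geometric mean step that produces [tau / 2], matching the subtracted term of
   [rho]. *)
have hP : `|P| <= tau / 2 * (Y + Z).
  apply: norm_le_of_sqr; first by apply: mulr_ge0; [exact: divr_ge0 | exact: addr_ge0].
  apply: (le_trans hP2); rewrite exprMn.
  have -> : (tau / 2) ^+ 2 * (Y + Z) ^+ 2 = tau ^+ 2 * (Y * Z) + tau ^+ 2 * ((Y - Z) / 2) ^+ 2.
    by field.
  by rewrite lerDl mulr_ge0 ?sqr_ge0.
have hG : `|G| <= (g2 + Y) / 2.
  apply: norm_le_of_sqr; first by apply: divr_ge0; [exact: addr_ge0|].
  apply: (le_trans hG2); rewrite -subr_ge0.
  have -> : ((g2 + Y) / 2) ^+ 2 - g2 * Y = ((g2 - Y) / 2) ^+ 2 by field.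
  exact: sqr_ge0.
(* The mean inequality is applied to [Y] and [chi ^+ 2 * Z], so that the uncontrolled [Z] keeps the
   weight [chi ^+ 2]. *)
have hN : `|2 * chi * k * (N / D)| <= Y + chi ^+ 2 * Z.
  rewrite (_ : 2 * chi * k * (N / D) = k * (2 * chi * (N / D))); last by ring.
  rewrite normrM; apply: (@le_trans _ _ (1 * `|2 * chi * (N / D)|)).
    by rewrite ler_wpM2r.
  rewrite mul1r; apply: norm_le_of_sqr.
    by apply: addr_ge0 => //; apply: mulr_ge0 => //; exact: sqr_ge0.
  apply: (@le_trans _ _ (4 * chi ^+ 2 * (Y * Z))).
    rewrite (_ : (2 * chi * (N / D)) ^+ 2 = 4 * chi ^+ 2 * (N / D) ^+ 2); last by ring.
    by apply: ler_wpM2l => //; apply: mulr_ge0 => //; exact: sqr_ge0.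
  rewrite -subr_ge0.
  have -> : (Y + chi ^+ 2 * Z) ^+ 2 - 4 * chi ^+ 2 * (Y * Z) = (Y - chi ^+ 2 * Z) ^+ 2 by ring.
  exact: sqr_ge0.
have hE : M * (Y + Z) - `|G| <= pa * (Y + Z) - G - P.
  have h0 : 0 <= (pa - M - tau / 2) * (Y + Z) by apply: mulr_ge0; [lra | exact: addr_ge0].
  have := ler_norm G; have := ler_norm P; lra.
rewrite hE'; set E' := pa * _ - _ - _ in hE *.
have c20 : 0 <= chi ^+ 2 by rewrite sqr_ge0.
have c21 : chi ^+ 2 <= 1 by rewrite expr_le1.
have h1 : chi ^+ 2 * (M * (Y + Z) - `|G|) <= chi ^+ 2 * E' by rewrite ler_wpM2l.
have h2 : chi ^+ 2 * `|G| <= `|G| by rewrite ler_piMl.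
have h3 : 0 <= chi ^+ 2 * Y by rewrite mulr_ge0.
(* Since [M >= 1], the main term [M chi^2 Z] absorbs the [chi^2 Z] lost to the cutoff. *)
have h4 : 0 <= (M - 1) * (chi ^+ 2 * Z) by apply: mulr_ge0; [lra | exact: mulr_ge0].
move: hN; rewrite ler_norml => /andP[hN _].
lra.
Qed.

(* [Re (y' conj(y) / p)], with [y = u + i v] and [p = pa + i pb] *)
Definition energy (u v u1 v1 pa pb : R -> R) (x : R) : R :=
  ((u1 x * u x + v1 x * v x) * pa x + (v1 x * u x - u1 x * v x) * pb x) /
  (pa x ^+ 2 + pb x ^+ 2).

(* the real and imaginary parts of [- y'' + p ^ 2 y = g], with [g = gu + i gv] *)
Definition schroedinger_sol s t (u v u1 v1 gu gv pa pb : R -> R) : Prop :=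
  [/\ ac s t u u1, ac s t v v1,
      ac s t u1 (fun x => (pa x ^+ 2 - pb x ^+ 2) * u x - 2 * pa x * pb x * v x - gu x) &
      ac s t v1 (fun x => (pa x ^+ 2 - pb x ^+ 2) * v x + 2 * pa x * pb x * u x - gv x)].

Lemma energy_step s t (u v u1 v1 gu gv pa pb pa1 pb1 tau : R -> R) (M k m : R) :
  s <= t -> schroedinger_sol s t u v u1 v1 gu gv pa pb ->
  ac s t pa pa1 -> ac s t pb pb1 ->
  (forall x, s <= x <= t -> 0 < pa x) -> (forall x, s <= x <= t -> 0 <= tau x) ->
  (forall x, s <= x <= t ->
     tau x ^+ 2 * (pa x ^+ 2 + pb x ^+ 2) = pa1 x ^+ 2 + pb1 x ^+ 2) ->
  {ae mu, forall x, s <= x <= t -> M + 2^-1 * tau x <= pa x} -> 1 <= M ->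
  (forall x, s <= x <= t -> 0 <= k * x + m <= 1) -> `|k| <= 1 ->
  iint s t (fun x => gu x ^+ 2 + gv x ^+ 2) ->
  intg s t (fun x => (M - 1) * ((k * x + m) ^+ 2 * (u x ^+ 2 + v x ^+ 2)) -
    (2^-1 * (gu x ^+ 2 + gv x ^+ 2) + 3 / 2 * (u x ^+ 2 + v x ^+ 2))) <=
  (k * t + m) ^+ 2 * energy u v u1 v1 pa pb t -
  (k * s + m) ^+ 2 * energy u v u1 v1 pa pb s.
Proof.
move=> st [hu hv hu1 hv1] hpa hpb pa0 tau0 htau hM M1 hchi k1 ig.
have hchi' : ac s t (fun x => k * x + m) (fun=> k) by exact: ac_affine.
have D0 x : s <= x <= t -> 0 < pa x * pa x + pb x * pb x.
  by move=> /pa0 p0; apply: ltr_pwDl; [exact: mulr_gt0 | rewrite -expr2 sqr_ge0].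
have hA := acD (ac_mul st hu1 hu) (ac_mul st hv1 hv).
have hB := acB (ac_mul st hv1 hu) (ac_mul st hu1 hv).
have hN := acD (ac_mul st hA hpa) (ac_mul st hB hpb).
have hD := ac_inv st (acD (ac_mul st hpa hpa) (ac_mul st hpb hpb)) D0.
have := ac_mul st (ac_mul st hchi' hchi') (ac_mul st hN hD).
(* [ff] is whatever density the product and inverse rules assembled; the closing [field] identifies
   it with the right side of [energy_pointwise]. *)
match goal with |- ac _ _ ?F ?f -> _ => pose FF := F; pose ff := f end.
rewrite -/FF -/ff => hF.
have EF x : FF x = (k * x + m) ^+ 2 * energy u v u1 v1 pa pb x.
  by rewrite /FF /energy !expr2.
rewrite -!EF (ac_sub hF) // ?lexx //.
have cY : {within `[s, t], continuous (fun x => u x ^+ 2 + v x ^+ 2)}.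
  apply: within_continuousD.
    by have := cont_mul (ac_cont hu) (ac_cont hu).
  by have := cont_mul (ac_cont hv) (ac_cont hv).
have iY : iint s t (fun x => u x ^+ 2 + v x ^+ 2) by exact: iint_cont.
apply: intg_ae_le; [|exact: hF.1|].
  apply: iintB; last by apply: iintD; exact: iintZ.
  apply: iintZ; apply: iint_cont; apply: cont_mul => //.
  exact: cont_mul (ac_cont hchi') (ac_cont hchi').
apply: ae_imp hM => x hx xst; have hMx := hx xst.
have /andP[c0 c1] := hchi x xst.
have := energy_pointwise (u x) (v x) (u1 x) (v1 x) (gu x) (gv x) M1 (tau0 x xst)
  (htau x xst) hMx c0 c1 k1.
move=> /le_trans; apply; rewrite le_eqVlt; apply/orP; left; apply/eqP.
rewrite /ff /=; have := D0 x xst; rewrite -!expr2 => D0x.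
have D0' : pa x ^+ 2 + pb x ^+ 2 != 0 by rewrite gt_eqF.
by field.
Qed.

Lemma schroedinger_solS s t s' t' u v u1 v1 gu gv pa pb : s <= s' -> t' <= t ->
  schroedinger_sol s t u v u1 v1 gu gv pa pb ->
  schroedinger_sol s' t' u v u1 v1 gu gv pa pb.
Proof.
move=> ss tt [h1 h2 h3 h4].
by split; [apply: acS h1 | apply: acS h2 | apply: acS h3 | apply: acS h4].
Qed.

(* The cutoff is the trapezoid rising on [X, X + 1] and falling on [N, N + 1];
   the boundary terms of the three pieces telescope. *)
Lemma energy_tail X N (u v u1 v1 gu gv pa pb pa1 pb1 tau : R -> R) (M A : R) :
  X + 1 <= N -> schroedinger_sol X (N + 1) u v u1 v1 gu gv pa pb ->
  ac X (N + 1) pa pa1 -> ac X (N + 1) pb pb1 ->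
  (forall x, X <= x <= N + 1 -> 0 < pa x) -> (forall x, X <= x <= N + 1 -> 0 <= tau x) ->
  (forall x, X <= x <= N + 1 ->
     tau x ^+ 2 * (pa x ^+ 2 + pb x ^+ 2) = pa1 x ^+ 2 + pb1 x ^+ 2) ->
  {ae mu, forall x, X <= x <= N + 1 -> M + 2^-1 * tau x <= pa x} -> 1 <= M ->
  iint X (N + 1) (fun x => gu x ^+ 2 + gv x ^+ 2) ->
  intg X (N + 1) (fun x => gu x ^+ 2 + gv x ^+ 2) <= A ->
  intg X (N + 1) (fun x => u x ^+ 2 + v x ^+ 2) <= A ->
  (M - 1) * intg (X + 1) N (fun x => u x ^+ 2 + v x ^+ 2) <= 2 * A.
Proof.
move=> XN hs hpa hpb pa0 tau0 htau hM M1 ig gA yA.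
set Y := fun x => u x ^+ 2 + v x ^+ 2 in yA *.
set g2 := fun x => gu x ^+ 2 + gv x ^+ 2 in ig gA *.
pose h x := 2^-1 * g2 x + 3 / 2 * Y x.
have [hu hv _ _] := hs.
have cY : {within `[X, N + 1], continuous Y}.
  apply: within_continuousD.
    by have := cont_mul (ac_cont hu) (ac_cont hu).
  by have := cont_mul (ac_cont hv) (ac_cont hv).
have iY : iint X (N + 1) Y by exact: iint_cont.
have ih : iint X (N + 1) h by apply: iintD; exact: iintZ.
have step s t k m : X <= s -> s <= t -> t <= N + 1 ->
    (forall x, s <= x <= t -> 0 <= k * x + m <= 1) -> `|k| <= 1 ->
    (M - 1) * intg s t (fun x => (k * x + m) ^+ 2 * Y x) - intg s t h <=
    (k * t + m) ^+ 2 * energy u v u1 v1 pa pb t -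
    (k * s + m) ^+ 2 * energy u v u1 v1 pa pb s.
  move=> Xs st tN hchi k1.
  have sub x : s <= x <= t -> X <= x <= N + 1.
    by move=> /andP[sx xt]; rewrite (le_trans Xs sx) (le_trans xt tN).
  have cchi : {within `[s, t], continuous (fun x => (k * x + m) ^+ 2)}.
    by have c := ac_cont (ac_affine s t k m); have := cont_mul c c.
  have cYst : {within `[s, t], continuous Y}.
    by apply: continuous_subspaceW cY; apply: subset_itv; rewrite bnd_simp.
  have iw : iint s t (fun x => (k * x + m) ^+ 2 * Y x).
    by apply: iint_cont; exact: cont_mul.
  have ihst : iint s t h by exact: iintS ih.
  rewrite -intgZ // -intgB //; last exact: iintZ.
  apply: (@energy_step s t u v u1 v1 gu gv pa pb pa1 pb1 tau M k m) => //.
  - exact: schroedinger_solS hs.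
  - exact: acS hpa.
  - exact: acS hpb.
  - by move=> x /sub; exact: pa0.
  - by move=> x /sub; exact: tau0.
  - by move=> x /sub; exact: htau.
  - by apply: ae_imp hM => x hx /sub.
  - exact: iintS ig.
have Y0 x : 0 <= Y x by rewrite addr_ge0 ?sqr_ge0.
have pos s t k m : 0 <= (M - 1) * intg s t (fun x => (k * x + m) ^+ 2 * Y x).
  rewrite mulr_ge0 ?subr_ge0 //; apply: intg_ge0 => x _.
  by apply: mulr_ge0 => //; exact: sqr_ge0.
have s1 : X <= X + 1 by rewrite lerDl.
have s3 : N <= N + 1 by rewrite lerDl.
have := step X (X + 1) 1 (- X) (lexx _) s1 (le_trans XN s3).
have := step (X + 1) N 0 1 s1 XN s3.
have := step N (N + 1) (-1) (N + 1) (le_trans s1 XN) s3 (lexx _).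
have -> : -1 * (N + 1) + (N + 1) = 0 by ring.
have -> : -1 * N + (N + 1) = 1 by ring.
have -> : 1 * (X + 1) + - X = 1 by ring.
have -> : 1 * X + - X = 0 by ring.
rewrite !mul0r !add0r !expr1n expr0n /= !mul0r !mul1r normrN normr1 normr0 subr0 sub0r.
move=> /(_ _ (lexx _)) h3 /(_ _ ler01) h2 /(_ _ (lexx _)) h1.
have E2 : intg (X + 1) N (fun x => (0 * x + 1) ^+ 2 * Y x) = intg (X + 1) N Y.
  by apply: intg_eq => x _; rewrite mul0r add0r expr1n mul1r.
rewrite E2 in h2.
have hh : intg X (N + 1) h = intg X (X + 1) h + intg (X + 1) N h + intg N (N + 1) h.
  rewrite (@intg_split _ X (X + 1) (N + 1)) ?s1 ?(le_trans XN) //.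
  rewrite (@intg_split _ (X + 1) N (N + 1)) ?XN ?s3 //; first by rewrite addrA.
  exact: iintS ih.
(* The weights [1/2] and [3/2] in [h], each against a bound [A], add up to the constant [2]. *)
have hA : intg X (N + 1) h <= 2 * A.
  by rewrite /h intgD ?intgZ //; try exact: iintZ; lra.
(* The integrals over the two sloping pieces are nonnegative and can be discarded. *)
have p1 := pos X (X + 1) 1 (- X); have p3 := pos N (N + 1) (-1) (N + 1).
have {}h1 : (M - 1) * intg X (X + 1) (fun x => (1 * x + - X) ^+ 2 * Y x) - intg X (X + 1) h <=
   energy u v u1 v1 pa pb (X + 1).
  by apply: h1 => x /andP[? ?]; apply/andP; split; lra.
have {}h3 : (M - 1) * intg N (N + 1) (fun x => (-1 * x + (N + 1)) ^+ 2 * Y x) - intg N (N + 1) h <=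
   - energy u v u1 v1 pa pb N.
  by apply: h3 => x /andP[? ?]; apply/andP; split; lra.
have {}h2 : (M - 1) * intg (X + 1) N Y - intg (X + 1) N h <=
   energy u v u1 v1 pa pb N - energy u v u1 v1 pa pb (X + 1).
  by apply: h2 => x _; rewrite mul0r add0r ler01 lexx.
lra.
Qed.

End Energy.

(** * Local bounds *)

Section LocalBound.
Variable R : realType.

Lemma below_average_point (a b A : R) (Y : R -> R) : a <= b ->
  {within `[a, b], continuous Y} -> intg a b Y <= A ->
  exists2 s, a <= s <= b & (b - a) * Y s <= A.
Proof.
move=> ab cY yA; have [s sab hs] := EVT_min ab cY.
exists s; first by move: sab; rewrite in_itv.
apply: le_trans yA; rewrite mulrC -intg_cst //; apply: intg_le.
- exact: iint_cst.
- exact: iint_cont.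
- by move=> x xab; apply: hs; rewrite in_itv.
Qed.

(** The mean of [F1] over [[s1, s2]] is the difference quotient of [F], hence at most
    [2 * kappa / (s2 - s1)], and [F1] deviates from its mean by at most its total oscillation
    [D]. *)
Lemma deriv_bound (a b D kappa s1 s2 : R) (F F1 F2 : R -> R) :
  ac a b F F1 -> ac a b F1 F2 -> intg a b (fun x => `|F2 x|) <= D ->
  a <= s1 -> s1 < s2 -> s2 <= b -> `|F s1| <= kappa -> `|F s2| <= kappa ->
  forall t, a <= t <= b -> `|F1 t| <= 2 * kappa / (s2 - s1) + D.
Proof.
move=> hF hF1 hD as1 s12 s2b k1 k2 t /andP[at_ tb].
have osc x y : a <= x -> x <= y -> y <= b -> `|F1 y - F1 x| <= D.
  move=> ax xy yb; rewrite (ac_sub hF1) //; apply: le_trans hD.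
  have ixy : iint x y F2 by exact: iintS hF1.1.
  apply: (le_trans (intg_norm ixy)); apply: intg_mono => //.
  exact: iint_norm hF1.1.
have osc' x : a <= x <= b -> `|F1 t - F1 x| <= D.
  move=> /andP[ax xb]; have [xt|tx] := leP x t; first exact: osc.
  by rewrite distrC; apply: osc => //; exact: ltW.
have d0 : 0 < s2 - s1 by rewrite subr_gt0.
have i1 : iint s1 s2 F1 by exact: iintS hF.1.
have e : (s2 - s1) * F1 t = (F s2 - F s1) + intg s1 s2 (fun x => F1 t - F1 x).
  rewrite intgB //; last exact: iint_cst.
  rewrite intg_cst ?ltW // -[intg s1 s2 (fun=> _)]/(intg s1 s2 F1).
  by rewrite -(ac_sub hF as1 (ltW s12) s2b); ring.
have h : `|intg s1 s2 (fun x => F1 t - F1 x)| <= D * (s2 - s1).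
  rewrite -(intg_cst _ (ltW s12)); apply: intg_norm_le.
  - by apply: iintB => //; exact: iint_cst.
  - exact: iint_cst.
  - by move=> x /andP[sx xs]; apply: osc'; rewrite (le_trans as1) // (le_trans xs).
have -> : F1 t = (s2 - s1) * F1 t / (s2 - s1) by field; rewrite gt_eqF.
rewrite normrM normfV (ger0_norm (ltW d0)) ler_pdivrMr // e mulrDl divfK ?gt_eqF //.
apply: (le_trans (ler_normD _ _)); apply: lerD => //.
by apply: (le_trans (ler_normB _ _)); lra.
Qed.

(** A bootstrap on [m], the maximum of [|u| + |v|]. The second derivatives have integral at most
    [Q * m + G], so two points where [u] and [v] are small bound the first derivatives, and
    integrating again gives [m <= 14 * kappa + 2 * h * (Q * m + G)]. The smallness [4 * h * Q <= 1]
    lets half of [m] be absorbed, which yields [B]. *)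
Lemma interval_bound (a h Q G A : R) (u v u1 v1 u2 v2 w gam : R -> R) :
  0 < h -> ac a (a + h) u u1 -> ac a (a + h) v v1 ->
  ac a (a + h) u1 u2 -> ac a (a + h) v1 v2 ->
  iint a (a + h) w -> iint a (a + h) gam ->
  (forall x, a <= x <= a + h -> 0 <= w x) ->
  (forall x, a <= x <= a + h -> `|u2 x| <= w x * (`|u x| + `|v x|) + gam x) ->
  (forall x, a <= x <= a + h -> `|v2 x| <= w x * (`|u x| + `|v x|) + gam x) ->
  intg a (a + h) w <= Q -> intg a (a + h) gam <= G -> 4 * h * Q <= 1 ->
  intg a (a + h) (fun x => u x ^+ 2 + v x ^+ 2) <= A ->
  let kappa := 1 + 3 * A / h in
  let B := 28 * kappa + 4 * h * G in
  forall x, a <= x <= a + h ->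
    [/\ `|u x| + `|v x| <= B, `|u1 x| <= 6 * kappa / h + (Q * B + G) &
        `|v1 x| <= 6 * kappa / h + (Q * B + G)].
Proof.
move=> h0 hu hv hu1 hv1 iw ig w0 bu bv wQ gG hQ yA kappa B.
have ah : a <= a + h by lra.
set b := a + h in hu hv hu1 hv1 iw ig w0 bu bv wQ gG yA ah *.
set Y := fun x => u x ^+ 2 + v x ^+ 2 in yA.
have cu := ac_cont hu; have cv := ac_cont hv.
have cY : {within `[a, b], continuous Y}.
  by apply: within_continuousD; [have := cont_mul cu cu | have := cont_mul cv cv].
have iY : iint a b Y by exact: iint_cont.
have Y0 x : 0 <= Y x by rewrite addr_ge0 ?sqr_ge0.
have cn : {within `[a, b], continuous (fun x => `|u x| + `|v x|)}.
  apply: within_continuousD.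
    by apply: (@within_continuous_comp _ _ _ _ u (@Num.norm _ R)) cu => // x _;
      exact: norm_continuous.
  by apply: (@within_continuous_comp _ _ _ _ v (@Num.norm _ R)) cv => // x _;
    exact: norm_continuous.
have cS c d : a <= c -> d <= b -> {within `[c, d], continuous Y}.
  by move=> ac_ db; apply: continuous_subspaceW cY; apply: subset_itv; rewrite bnd_simp.
have sm c d : a <= c -> c <= d -> d <= b -> intg c d Y <= A.
  by move=> ac_ cd db; apply: le_trans yA; apply: intg_mono.
(* On an interval of length [h / 3] the minimum of [Y] is at most [3 * A / h], and
   [|z| <= 1 + z ^+ 2] turns this into [kappa]. *)
have pt c d : a <= c -> c <= d -> d <= b -> d - c = h / 3 ->
    exists2 s, c <= s <= d & `|u s| <= kappa /\ `|v s| <= kappa.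
  move=> ac_ cd db dc.
  have [s sI hs] := below_average_point cd (cS _ _ ac_ db) (sm _ _ ac_ cd db).
  exists s => //; rewrite dc in hs.
  have hY : Y s <= 3 * A / h by rewrite ler_pdivlMr //; lra.
  have nb (z : R) : `|z| <= 1 + z ^+ 2.
    rewrite -(real_normK (num_real z)); have := normr_ge0 z; set n := `|z|.
    have := sqr_ge0 (n - 2^-1); rewrite sqrrB; nra.
  have := sqr_ge0 (u s); have := sqr_ge0 (v s); have := nb (u s); have := nb (v s).
  by rewrite /kappa; move: hY; rewrite /Y => *; split; lra.
(* One point is taken in the first third and one in the last, so they lie at least [h / 3] apart. *)
have [||||s1 /andP[as1 s1a] [us1 vs1]] := @pt a (a + h / 3);
  try by rewrite /b; lra.
have [||||s2 /andP[as2 s2b] [us2 vs2]] := @pt (b - h / 3) b;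
  try by rewrite /b; lra.
have s12 : h / 3 <= s2 - s1 by rewrite /b in as2; lra.
have kappa0 : 0 <= kappa := le_trans (normr_ge0 _) us1.
have [c cab hm] := EVT_max ah cn.
set m := `|u c| + `|v c| in hm.
have cab' : a <= c <= b by move: cab; rewrite in_itv.
have m0 : 0 <= m by rewrite addr_ge0.
have i2 : iint a b (fun x => m * w x + gam x) by apply: iintD => //; exact: iintZ.
have i2le : intg a b (fun x => m * w x + gam x) <= Q * m + G.
  rewrite intgD //; last exact: iintZ.
  by rewrite intgZ //; apply: lerD => //; rewrite mulrC ler_wpM2r.
have d2 F2 : iint a b F2 ->
   (forall x, a <= x <= b -> `|F2 x| <= w x * (`|u x| + `|v x|) + gam x) ->
   intg a b (fun x => `|F2 x|) <= Q * m + G.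
  move=> iF2 bF2; apply: le_trans i2le; apply: intg_le => //; first exact: iint_norm.
  move=> x xab; apply: (le_trans (bF2 x xab)); rewrite lerD2r mulrC ler_wpM2r ?w0 //.
  by apply: hm; rewrite in_itv.
have q1 : 2 * kappa / (s2 - s1) <= 6 * kappa / h.
  have -> : 6 * kappa / h = 2 * kappa / (h / 3) by field; rewrite gt_eqF.
  apply: ler_wpM2l; first by rewrite mulr_ge0.
  by rewrite lef_pV2 ?posrE //; lra.
have dF F F1 F2 : ac a b F F1 -> ac a b F1 F2 ->
    (forall x, a <= x <= b -> `|F2 x| <= w x * (`|u x| + `|v x|) + gam x) ->
    `|F s1| <= kappa -> `|F s2| <= kappa ->
    forall x, a <= x <= b -> `|F1 x| <= 6 * kappa / h + (Q * m + G).
  move=> hF hF1 bF2 k1 k2 x xab.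
  have := deriv_bound hF hF1 (d2 _ hF1.1 bF2) as1 _ s2b k1 k2 xab.
  have l12 : s1 < s2 by lra.
  by move=> /(_ l12) /le_trans; apply; rewrite lerD2r.
have dF0 F F1 : ac a b F F1 -> `|F s1| <= kappa ->
    (forall x, a <= x <= b -> `|F1 x| <= 6 * kappa / h + (Q * m + G)) ->
    forall x, a <= x <= b -> `|F x| <= 7 * kappa + h * (Q * m + G).
  move=> hF k1 bF1; set C := 6 * kappa / h + (Q * m + G) in bF1 *.
  have C0 : 0 <= C by apply: le_trans (bF1 c cab').
  have lip x y : a <= x -> x <= y -> y <= b -> `|F y - F x| <= h * C.
    move=> ax xy yb; rewrite (ac_sub hF) //.
    apply: (@le_trans _ _ (intg x y (fun=> C))).
      apply: intg_norm_le; [exact: iintS hF.1|exact: iint_cst|].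
      by move=> z /andP[xz zy]; apply: bF1; rewrite (le_trans ax xz) (le_trans zy yb).
    rewrite intg_cst // mulrC; apply: ler_wpM2r => //.
    by move: yb; rewrite /b; lra.
  move=> x /andP[ax xb].
  have hC : h * C = 6 * kappa + h * (Q * m + G).
    by rewrite /C; field; rewrite gt_eqF.
  have : `|F x - F s1| <= h * C.
    have [sx|xs] := leP s1 x; first exact: lip.
    by rewrite distrC; apply: lip => //; [exact: ltW | lra].
  by rewrite -{2}(subrK (F s1) (F x)) => hx; apply: (le_trans (ler_normD _ _)); lra.
have du := dF _ _ _ hu hu1 bu us1 us2; have dv := dF _ _ _ hv hv1 bv vs1 vs2.
have eu := dF0 _ _ hu us1 du; have ev := dF0 _ _ hv vs1 dv.
have mB : m <= B.
  have := eu c cab'; have := ev c cab'; rewrite -/m.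
  have : 4 * h * Q * m <= 1 * m by rewrite ler_wpM2r.
  rewrite /B /m; lra.
have Q0 : 0 <= Q by apply: le_trans wQ; exact: intg_ge0.
have QmB : Q * m <= Q * B by rewrite ler_wpM2l.
move=> x xab; split.
- by apply: le_trans mB; apply: hm; rewrite in_itv.
- by apply: (le_trans (du x xab)); lra.
- by apply: (le_trans (dv x xab)); lra.
Qed.

End LocalBound.

(** * Limits along an ultrafilter *)

Section Compactness.
Variable R : realType.
Variable U : set_system nat.
Hypothesis UU : UltraFilter U.

#[local] Instance U_proper : ProperFilter U := ultra_proper.

Lemma ultra_lim (a : nat -> R) (B : R) : (forall n, `|a n| <= B) ->
  exists l : R, forall e : R, 0 < e -> U [set n | `|a n - l| < e].
Proof.
move=> aB; have FB : (a @ U) `[- B, B]%classic.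
  apply: (@filterS _ U _ setT) => [n _|]; last exact: filterT.
  by rewrite /= in_itv /= -ler_norml; exact: aB.
have [l [_ cl]] := @segment_compact R (- B) B (a @ U) _ FB.
(* An ultrafilter contains the set or its complement; the complement is excluded because the cluster
   point [l] would have to meet both a ball and the outside of that ball. *)
exists l => e e0; have [//|nU] := in_ultra_setVsetC [set n | `|a n - l| < e] UU.
have [] := cl (~` ball l e) (ball l e); [| exact: nbhsx_ballx |].
  by apply: (@filterS _ U _ _ _ _ nU) => n /= h; rewrite /ball /= distrC.
by move=> x [].
Qed.

(** The functions are controlled only for nonnegative arguments; taking [|x|] extends the limit
    evenly, so that it can be continuous, and thus measurable, on the whole line. *)
Lemma ultra_lim_fun (u : nat -> R -> R) :
  (forall N : R, exists B : R, forall n (x : R), 0 <= x <= N -> `|u n x| <= B) ->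
  exists g : R -> R, forall x e : R, 0 < e -> U [set n | `|u n `|x| - g x| < e].
Proof.
move=> ub.
have h (x : R) : exists l : R, forall e : R, 0 < e -> U [set n | `|u n `|x| - l| < e].
  have [B hB] := ub `|x|; apply: (@ultra_lim (fun n => u n `|x|) B) => n.
  by apply: hB; rewrite normr_ge0 lexx.
by have [g hg] := choice h; exists g.
Qed.

Lemma ultra_lim_lip (u : nat -> R -> R) (g : R -> R) (N B : R) :
  (forall x e : R, 0 < e -> U [set n | `|u n `|x| - g x| < e]) ->
  (forall n (x y : R), 0 <= x -> x <= y -> y <= N -> `|u n y - u n x| <= B * (y - x)) ->
  forall x y : R, 0 <= x -> x <= y -> y <= N -> `|g y - g x| <= B * (y - x).
Proof.
move=> ug ul x y x0 xy yN; apply/ler_addgt0Pl => e e0.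
have e20 : 0 < e / 2 by rewrite divr_gt0.
have [n [hx hy]] := filter_ex (filterI (ug x _ e20) (ug y _ e20)).
rewrite /= (ger0_norm x0) in hx; rewrite /= (ger0_norm (le_trans x0 xy)) in hy.
have := ul n x y x0 xy yN.
move: hx hy; rewrite !ltr_norml !ler_norml => /andP[? ?] /andP[? ?] /andP[? ?].
apply/andP; split; lra.
Qed.

(* A finite net turns pointwise convergence along U of an equi-Lipschitz family
   into uniform convergence. *)
Lemma ultra_lim_unif (u : nat -> R -> R) (g : R -> R) (N e : R) :
  (forall x e : R, 0 < e -> U [set n | `|u n `|x| - g x| < e]) ->
  (exists B : R, forall n (x y : R), 0 <= x -> x <= y -> y <= N -> `|u n y - u n x| <= B * (y - x)) ->
  0 < e -> U [set n | forall x : R, 0 <= x <= N -> `|u n x - g x| <= e].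
Proof.
move=> ug [B0 ul0] e0; pose B := `|B0| + 1.
have B_gt0 : 0 < B by rewrite ltr_wpDl.
have ul n x y : 0 <= x -> x <= y -> y <= N -> `|u n y - u n x| <= B * (y - x).
  move=> x0 xy yN; apply: (le_trans (ul0 n x y x0 xy yN)).
  by apply: ler_wpM2r; [lra | rewrite /B; have := ler_norm B0; lra].
pose d := e / 3 / B; have d0 : 0 < d by rewrite !divr_gt0.
(* The net consists of the multiples of the mesh [d = e / (3 B)]; the successor includes the last
   multiple not exceeding [N]. Rounding down costs [e / 3] for [u n], [e / 3] for [g], and [e / 3]
   remains for the node itself. *)
pose K := (Num.truncn (N / d)).+1.
have e30 : 0 < e / 3 by rewrite divr_gt0.
have FU : Filter U by exact: filter_filter.
have := @filter_forall nat 'I_K (fun i => [set n | `|u n `|i%:R * d| - g (i%:R * d)| < e / 3]) U FU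
  (fun i => ug _ _ e30).
apply: (@filterS _ U) => n /= hn x /andP[x0 xN].
have xd0 : 0 <= x / d by rewrite divr_ge0 // ltW.
have /andP[ix xi] := truncn_itv xd0; set i := Num.truncn (x / d) in ix xi.
have iK : (i < K)%N by rewrite ltnS; apply: le_truncn; rewrite ler_pM2r ?invr_gt0.
have z0 : 0 <= i%:R * d by rewrite mulr_ge0 // ltW.
have := hn (Ordinal iK); rewrite /= (ger0_norm z0).
rewrite ler_pdivlMr // in ix; rewrite ltr_pdivrMr // in xi.
set z := i%:R * d in ix z0 *.
have xz : x - z <= d by move: xi; rewrite -natr1 mulrDl mul1r -/z; lra.
have bz : B * (x - z) <= e / 3.
  have -> : e / 3 = B * d by rewrite /d; field; rewrite gt_eqF.
  by rewrite ler_pM2l.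
have := ul n z x z0 ix xN; have := ultra_lim_lip ug ul z0 ix xN.
rewrite !ltr_norml !ler_norml => /andP[? ?] /andP[? ?] /andP[? ?].
apply/andP; split; lra.
Qed.

Lemma ultra_lim_continuous (u : nat -> R -> R) (g : R -> R) :
  (forall x e : R, 0 < e -> U [set n | `|u n `|x| - g x| < e]) ->
  (forall N : R, exists B : R, forall n (x y : R), 0 <= x -> x <= y -> y <= N ->
     `|u n y - u n x| <= B * (y - x)) ->
  continuous g.
Proof.
move=> ug ul x.
(* [g z] and [g |z|] are limits of the same sequence, so [g] is even and continuity reduces to the
   Lipschitz bound on nonnegative arguments. *)
have gabs z : g z = g `|z|.
  apply/eqP; rewrite -subr_eq0 -normr_le0; apply/ler_addgt0Pl => e e0; rewrite addr0.
  have e20 : 0 < e / 2 by rewrite divr_gt0.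
  have [n [hx hy]] := filter_ex (filterI (ug z _ e20) (ug `|z| _ e20)).
  rewrite /= normr_id in hx hy; move: hx hy.
  rewrite !ltr_norml !ler_norml => /andP[? ?] /andP[? ?]; apply/andP; split; lra.
have [B0 hB0] := ul (`|x| + 1); pose B := `|B0| + 1.
have B_gt0 : 0 < B by rewrite ltr_wpDl.
have hB y z : 0 <= y -> y <= z -> z <= `|x| + 1 -> `|g z - g y| <= B * (z - y).
  move=> y0 yz zN; apply: (le_trans (ultra_lim_lip ug hB0 y0 yz zN)).
  by apply: ler_wpM2r; [lra | rewrite /B; have := ler_norm B0; lra].
have hB' y : `|y| <= `|x| + 1 -> `|g x - g y| <= B * `|x - y|.
  move=> yx; rewrite (gabs x) (gabs y).
  apply: (@le_trans _ _ (B * `| `|x| - `|y| |)); last first.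
    by rewrite ler_pM2l //; exact: ler_dist_dist.
  have [xy|yx'] := leP `|x| `|y|.
    by rewrite distrC (distrC `|x|) (ger0_norm (_ : 0 <= `|y| - `|x|)) ?subr_ge0 //; exact: hB.
  have xy0 : 0 <= `|x| - `|y| by rewrite subr_ge0 ltW.
  rewrite (ger0_norm xy0); apply: hB => //; first exact: ltW.
  by rewrite lerDl.
apply/cvgrPdist_le => /= e e0; near=> y.
have xy : `|x - y| < Num.min 1 (e / B).
  near: y; apply: (@cvgr_dist_lt _ _ _ _ _ id x) => //.
  by rewrite lt_min ltr01 divr_gt0.
move: xy; rewrite lt_min => /andP[xy1 xye].
apply: (le_trans (hB' y _)).
  have -> : y = x - (x - y) by ring.
  by apply: (le_trans (ler_normB _ _)); rewrite lerD2l ltW.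
by rewrite mulrC -ler_pdivlMr // ltW.
Unshelve. all: by end_near.
Qed.

End Compactness.

(** * Extraction of a subsequence converging in L2 *)

Section Subsequence.
Variable R : realType.

Lemma cont_sqdist (N : R) (u v g h : R -> R) :
  {within `[0, N], continuous u} -> {within `[0, N], continuous v} ->
  {within `[0, N], continuous g} -> {within `[0, N], continuous h} ->
  {within `[0, N], continuous (fun x => (u x - g x) ^+ 2 + (v x - h x) ^+ 2)}.
Proof.
move=> cu cv cg ch; apply: within_continuousD.
  by have c := within_continuousB cu cg; have := cont_mul c c.
by have c := within_continuousB cv ch; have := cont_mul c c.
Qed.

Lemma subsequence_of_sets (S : nat -> set nat) :
  (forall k n, exists2 m, (n < m)%N & S k m) ->
  exists phi : nat -> nat,
    (forall n m, (n < m)%N -> (phi n < phi m)%N) /\ forall k, S k (phi k).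
Proof.
move=> hS; have h (kn : nat * nat) : exists m, (kn.2 < m)%N /\ S kn.1 m.
  by have [m ? ?] := hS kn.1 kn.2; exists m.
have [f hf] := choice h.
pose phi := fix phi k := if k is k'.+1 then f (k, phi k') else f (0, 0)%N.
exists phi; split.
  move=> n m; apply: (@homo_ltn _ phi (fun x y => (x < y)%N)); first exact: ltn_trans.
  by move=> k; exact: (hf (k.+1, phi k)).1.
by case=> [|k]; [exact: (hf (0, 0)%N).2 | exact: (hf (k.+1, phi k)).2].
Qed.

(** The ultrafilter yields the limit at all points at once, in place of a diagonal extraction.
    Subsequences return only at the end: each set of indices with L2 distance to the limit at most
    [1/(k+1)] belongs to the ultrafilter and therefore has arbitrarily large elements. *)
Lemma compact_subsequence (u v : nat -> R -> R) :
  (forall n N, {within `[0, N], continuous (u n)}) ->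
  (forall n N, {within `[0, N], continuous (v n)}) ->
  (forall N : R, exists B : R, forall n (x : R), 0 <= x <= N ->
     `|u n x| <= B /\ `|v n x| <= B) ->
  (forall N : R, exists B : R, forall n (x y : R), 0 <= x -> x <= y -> y <= N ->
     `|u n y - u n x| <= B * (y - x) /\ `|v n y - v n x| <= B * (y - x)) ->
  (forall e : R, 0 < e -> exists2 X : R, 0 <= X & forall n N, X <= N ->
     intg X N (fun x => u n x ^+ 2 + v n x ^+ 2) <= e) ->
  exists (phi : nat -> nat) (g h : R -> R),
    [/\ (forall n m, (n < m)%N -> (phi n < phi m)%N), continuous g, continuous h &
        forall k N, 0 <= N ->
          intg 0 N (fun x => (u (phi k) x - g x) ^+ 2 + (v (phi k) x - h x) ^+ 2) <=
          k.+1%:R^-1].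
Proof.
move=> cu cv hb hl ht.
have [U [UU oU]] := @ultraFilterLemma nat \oo _.
have PU : ProperFilter U := ultra_proper.
have FU : Filter U by exact: filter_filter.
have hbu (N : R) : exists B : R, forall n (x : R), 0 <= x <= N -> `|u n x| <= B.
  by have [B hB] := hb N; exists B => n x /(hB n) [].
have hbv (N : R) : exists B : R, forall n (x : R), 0 <= x <= N -> `|v n x| <= B.
  by have [B hB] := hb N; exists B => n x /(hB n) [].
have hlu (N : R) : exists B : R, forall n (x y : R), 0 <= x -> x <= y -> y <= N ->
     `|u n y - u n x| <= B * (y - x).
  by have [B hB] := hl N; exists B => n x y x0 xy yN; have [] := hB n x y x0 xy yN.
have hlv (N : R) : exists B : R, forall n (x y : R), 0 <= x -> x <= y -> y <= N ->
     `|v n y - v n x| <= B * (y - x).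
  by have [B hB] := hl N; exists B => n x y x0 xy yN; have [] := hB n x y x0 xy yN.
have [g ug] := ultra_lim_fun UU hbu; have [h vh] := ultra_lim_fun UU hbv.
have cg := ultra_lim_continuous UU ug hlu; have ch := ultra_lim_continuous UU vh hlv.
pose d n x := (u n x - g x) ^+ 2 + (v n x - h x) ^+ 2.
pose Y n x := u n x ^+ 2 + v n x ^+ 2.
have cd n N : {within `[0, N], continuous (d n)}.
  by apply: cont_sqdist => //; exact: continuous_subspaceT.
have cY n N : {within `[0, N], continuous (Y n)}.
  apply: within_continuousD.
    by have := cont_mul (cu n N) (cu n N).
  by have := cont_mul (cv n N) (cv n N).
have d0 n x : 0 <= d n x by rewrite addr_ge0 ?sqr_ge0.
have Y0 n x : 0 <= Y n x by rewrite addr_ge0 ?sqr_ge0.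
have id_ n N : iint 0 N (d n) by exact: iint_cont.
have iY n N : iint 0 N (Y n) by exact: iint_cont.
have small (N e : R) : 0 <= N -> 0 < e -> U [set n | intg 0 N (d n) <= e].
  (* Capping [c] at [1] makes [|z| <= c] imply [z ^+ 2 <= c]; the other bound ensures
     [2 * c * N <= e]. *)
  move=> N0 e0; pose c := Num.min 1 (e / (2 * (N + 1))).
  have N1 : 0 < 2 * (N + 1) by lra.
  have c0 : 0 < c by rewrite lt_min ltr01 divr_gt0.
  have c1 : c <= 1 by rewrite ge_min lexx.
  have ce : c * (2 * (N + 1)) <= e by rewrite -ler_pdivlMr // ge_min lexx orbT.
  have hu := ultra_lim_unif UU ug (hlu N) c0; have hv := ultra_lim_unif UU vh (hlv N) c0.
  apply: (@filterS _ U _ _ _ _ (filterI hu hv)) => n /= [hn1 hn2].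
  have sq (z : R) : `|z| <= c -> z ^+ 2 <= c.
    move=> zc; rewrite -(real_normK (num_real z)); have := normr_ge0 z.
    by move: zc c0 c1; set w := `|z|; nra.
  apply: (@le_trans _ _ (intg 0 N (fun=> 2 * c))).
    apply: intg_le => //; first exact: iint_cst.
    move=> x xN; have := sq _ (hn1 x xN); have := sq _ (hn2 x xN); rewrite /d; lra.
  rewrite intg_cst // subr0; lra.
have close (e : R) : 0 < e -> U [set n | forall N, 0 <= N -> intg 0 N (d n) <= e].
  (* The budget is [e/4] on [[0, X]], then [4 * e/32] twice for the tails and [2 * e/4] for the
     auxiliary index. *)
  move=> e0; have e1 : 0 < e / 32 by rewrite divr_gt0.
  have e4 : 0 < e / 4 by rewrite divr_gt0.
  have [X X0 hX] := ht _ e1.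
  apply: (@filterS _ U _ _ _ _ (small X _ X0 e4)) => n /= hn N N0.
  have [NX|XN] := leP N X.
    apply: (@le_trans _ _ (e / 4)); last by lra.
    by apply: le_trans hn; apply: intg_mono.
  (* No tail estimate is known yet for the limit, so on [[X, N]] it is replaced by some [u m], [v m]
     close to it on [[0, N]]. The index [m] depends on [N], but the resulting bound does not. *)
  have [m /= hm] := filter_ex (small N _ N0 e4).
  have sI f : iint 0 N f -> iint X N f by exact: iintS.
  rewrite (@intg_split _ 0 X N) ?X0 ?(ltW XN) //.
  have : intg X N (d n) <= intg X N (fun x => (4 * Y n x + 4 * Y m x) + 2 * d m x).
    apply: intg_le; first exact: sI.
      by apply: iintD; [apply: iintD|]; apply: iintZ; exact: sI.
    move=> x _; rewrite /d /Y.
    have key (a b c : R) : (a - c) ^+ 2 <= 4 * a ^+ 2 + 4 * b ^+ 2 + 2 * (b - c) ^+ 2.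
      rewrite -subr_ge0; have -> : 4 * a ^+ 2 + 4 * b ^+ 2 + 2 * (b - c) ^+ 2 - (a - c) ^+ 2
        = 2 * (a + b) ^+ 2 + (a - 2 * b + c) ^+ 2 by ring.
      by apply: addr_ge0; [apply: mulr_ge0 => //|]; exact: sqr_ge0.
    have := key (u n x) (u m x) (g x); have := key (v n x) (v m x) (h x); lra.
  have iYn := sI _ (iY n N); have iYm := sI _ (iY m N); have idm := sI _ (id_ m N).
  have -> : intg X N (fun x => (4 * Y n x + 4 * Y m x) + 2 * d m x) =
      4 * intg X N (Y n) + 4 * intg X N (Y m) + 2 * intg X N (d m).
    rewrite intgD; [|by apply: iintD; exact: iintZ|exact: iintZ].
    by rewrite intgD; [|exact: iintZ|exact: iintZ]; rewrite !intgZ.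
  have := hX n N (ltW XN); have := hX m N (ltW XN); rewrite -/(Y n) -/(Y m).
  have : intg X N (d m) <= e / 4 by apply: le_trans hm; apply: intg_mono => //; exact: ltW.
  lra.
have hS k n : exists2 m, (n < m)%N & forall N, 0 <= N -> intg 0 N (d m) <= k.+1%:R^-1.
  have ek : 0 < k.+1%:R^-1 :> R by rewrite invr_gt0.
  (* The ultrafilter refines convergence to infinity, so it contains every final segment of nat. *)
  have hn : U [set m | (n < m)%N] by apply: oU; exact: nbhs_infty_gt.
  by have [m [/= nm hm]] := filter_ex (filterI hn (close _ ek)); exists m.
have [phi [phi_inc hphi]] := subsequence_of_sets hS.
by exists phi, g, h; split.
Qed.

End Subsequence.

(** * Complex-valued functions *)

Section ComplexValued.
Variable R : realType.
Local Notation mu := (@lebesgue_measure R).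
Implicit Types (f g y q p : R -> R[i]) (z w : R[i]).

Lemma ReD z w : complex.Re (z + w) = complex.Re z + complex.Re w.
Proof. by case: z; case: w. Qed.
Lemma ImD z w : complex.Im (z + w) = complex.Im z + complex.Im w.
Proof. by case: z; case: w. Qed.
Lemma ReN z : complex.Re (- z) = - complex.Re z.
Proof. by case: z. Qed.
Lemma ImN z : complex.Im (- z) = - complex.Im z.
Proof. by case: z. Qed.
Lemma ReM z w :
  complex.Re (z * w) = complex.Re z * complex.Re w - complex.Im z * complex.Im w.
Proof. by case: z; case: w. Qed.
Lemma ImM z w :
  complex.Im (z * w) = complex.Re z * complex.Im w + complex.Im z * complex.Re w.
Proof. by case: z => a b; case: w. Qed.

Definition reimE := (ReD, ImD, ReN, ImN, ReM, ImM).

Definition sqn f (x : R) : R := cRe f x ^+ 2 + cIm f x ^+ 2.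

Lemma cabs_sqr z : cabs z ^+ 2 = complex.Re z ^+ 2 + complex.Im z ^+ 2.
Proof. by case: z => a b; rewrite /cabs /= sqr_sqrtr // addr_ge0 ?sqr_ge0. Qed.

Lemma sqn_ge0 f x : 0 <= sqn f x.
Proof. by rewrite /sqn addr_ge0 ?sqr_ge0. Qed.

Lemma AC_loc_ac (c a b : R) y y1 : AC_loc_with c y y1 -> c <= a -> a <= b ->
  ac a b (cRe y) (cRe y1) /\ ac a b (cIm y) (cIm y1).
Proof.
move=> [li hy] ca ab; have cb := le_trans ca ab.
have [ir ii] := li b cb; rewrite ccE in ir ii.
split; apply: (@acS _ c b) => //; split=> // x /andP[cx xb].
  by rewrite /cRe (hy x cx) ReD /cintegral /= ccE.
by rewrite /cIm (hy x cx) ImD /cintegral /= ccE.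
Qed.

Lemma measurable_Rplus : measurable (@Rplus R : set (measurableTypeR R)).
Proof.
have -> : @Rplus R = `[0, +oo[%classic.
  by apply/seteqP; split=> x; rewrite /= in_itv /= andbT.
exact: measurable_itv.
Qed.

Lemma sqn_EFin f : (fun x => ((cabs (f x)) ^+ 2)%:E) = EFin \o sqn f.
Proof. by apply/funext => x /=; rewrite cabs_sqr. Qed.

Lemma sqn_measurable f (D : set R) : measurable_fun D (cRe f) ->
  measurable_fun D (cIm f) -> measurable_fun D (sqn f).
Proof. by move=> mr mi; apply: measurable_funD; exact: measurable_funX. Qed.

Lemma L2_integrable f : L2 f -> mu.-integrable (@Rplus R) (EFin \o sqn f).
Proof.
move=> [mr mi fi]; apply/integrableP; split.
  by apply/measurable_EFinP; exact: sqn_measurable.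
move: fi; rewrite sqn_EFin; congr (_ < _)%E; apply: eq_integral => x _ /=.
by rewrite ger0_norm ?sqn_ge0.
Qed.

Lemma sub_Rplus (a b : R) : 0 <= a -> `[a, b] `<=` @Rplus R.
Proof. by move=> a0 x /=; rewrite in_itv /= => /andP[ax _]; exact: le_trans ax. Qed.

Lemma L2_iint (a b : R) f : 0 <= a -> L2 f -> iint a b (sqn f).
Proof.
move=> a0 /L2_integrable; apply: integrableS.
- exact: measurable_Rplus.
- exact: mitv.
- exact: sub_Rplus.
Qed.

Lemma norm2_sqr f : norm2 f ^+ 2 = fine (\int[mu]_(x in @Rplus R) (EFin \o sqn f) x)%E.
Proof.
rewrite /norm2 sqn_EFin sqr_sqrtr //; apply: fine_ge0; apply: integral_ge0 => x _.
by rewrite lee_fin sqn_ge0.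
Qed.

Lemma intg_sqn_le (a b : R) f : 0 <= a -> L2 f -> intg a b (sqn f) <= norm2 f ^+ 2.
Proof.
move=> a0 Lf; have fi := L2_integrable Lf; rewrite norm2_sqr; apply: fine_le.
- by apply: integrable_fin_num => //; exact: L2_iint.
- by apply: integrable_fin_num => //; exact: measurable_Rplus.
apply: ge0_subset_integral => //.
- exact: measurable_Rplus.
- exact: measurable_int fi.
- by move=> x _; rewrite lee_fin sqn_ge0.
- exact: sub_Rplus.
Qed.

(** Monotone convergence along the intervals [[0, i]], which exhaust the half-line. *)
Lemma integral_sqn_le f (e : R) : (forall N, 0 <= N -> iint 0 N (sqn f)) ->
  (forall N, 0 <= N -> intg 0 N (sqn f) <= e) ->
  (\int[mu]_(x in @Rplus R) (EFin \o sqn f) x <= e%:E)%E.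
Proof.
move=> fi fe.
pose F (i : nat) : set R := `[0, i%:R]%classic.
have UF : \bigcup_i F i = @Rplus R.
  apply/seteqP; split=> x /=.
    by move=> [i _]; rewrite /F /= in_itv /= => /andP[].
  move=> x0; exists (Num.bound x) => //; rewrite /F /= in_itv /= x0 /=.
  by apply: ltW; exact: archi_boundP.
have ndF : nondecreasing_seq F.
  move=> i j ij; apply/subsetPset; apply: subset_itv; rewrite bnd_simp //.
  by rewrite ler_nat.
have iF i : mu.-integrable (F i) (EFin \o sqn f) by exact: fi.
have mF i : measurable (F i : set (measurableTypeR R)) by exact: mitv.
have mf i : measurable_fun (F i) (EFin \o sqn f) by exact: measurable_int (iF i).
have f0 i x : F i x -> (0 <= (EFin \o sqn f) x)%E by rewrite lee_fin sqn_ge0.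
have cvgF := @ge0_nondecreasing_set_cvg_integral _ (measurableTypeR R) R F
  (EFin \o sqn f) mu ndF mF mf f0.
rewrite UF in cvgF; rewrite -(cvg_lim _ cvgF) //.
apply: lime_le; first by apply/cvg_ex; eexists; exact: cvgF.
apply: nearW => i; rewrite -[leLHS]fineK ?lee_fin; first exact: fe.
by apply: integrable_fin_num => //; exact: iF.
Qed.

Lemma norm2_le f (e : R) : 0 <= e -> (forall N, 0 <= N -> iint 0 N (sqn f)) ->
  (forall N, 0 <= N -> intg 0 N (sqn f) <= e) -> norm2 f <= Num.sqrt e.
Proof.
move=> e0 fi fe; rewrite /norm2 sqn_EFin; apply: ler_wsqrtr.
have h := integral_sqn_le fi fe.
have h0 : (0 <= \int[mu]_(x in @Rplus R) (EFin \o sqn f) x)%E.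
  by apply: integral_ge0 => x _; rewrite lee_fin sqn_ge0.
rewrite -lee_fin fineK // ge0_fin_numE //; exact: le_lt_trans h (ltry _).
Qed.

Lemma L2_of_bounded f (e : R) : measurable_fun (@Rplus R) (cRe f) ->
  measurable_fun (@Rplus R) (cIm f) -> (forall N, 0 <= N -> iint 0 N (sqn f)) ->
  (forall N, 0 <= N -> intg 0 N (sqn f) <= e) -> L2 f.
Proof.
move=> mr mi fi fe; split=> //; rewrite sqn_EFin.
exact: le_lt_trans (integral_sqn_le fi fe) (ltry _).
Qed.

Lemma L2_lin f g z : L2 f -> L2 g -> L2 (fun x => f x - z * g x).
Proof.
move=> Lf Lg; have [fr fi _] := Lf; have [gr gi _] := Lg.
have mr : measurable_fun (@Rplus R) (cRe (fun x => f x - z * g x)).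
  rewrite (_ : cRe _ = fun x => cRe f x - (complex.Re z * cRe g x - complex.Im z * cIm g x)).
    by apply: measurable_funB => //; apply: measurable_funB;
      apply: measurable_funM => //; exact: measurable_cst.
  by apply/funext => x; rewrite /cRe /cIm !reimE.
have mi : measurable_fun (@Rplus R) (cIm (fun x => f x - z * g x)).
  rewrite (_ : cIm _ = fun x => cIm f x - (complex.Re z * cIm g x + complex.Im z * cRe g x)).
    by apply: measurable_funB => //; apply: measurable_funD;
      apply: measurable_funM => //; exact: measurable_cst.
  by apply/funext => x; rewrite /cRe /cIm !reimE.
split=> //; rewrite sqn_EFin.
pose k := 2 * (complex.Re z ^+ 2 + complex.Im z ^+ 2).
have i2 : mu.-integrable (@Rplus R) (fun x =>
    (2%:E * (EFin \o sqn f) x + k%:E * (EFin \o sqn g) x)%E).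
  by apply: integrableD; [exact: measurable_Rplus | |]; apply: integrableZl;
    try exact: measurable_Rplus; exact: L2_integrable.
apply: le_lt_trans (integral_fune_lt_pinfty measurable_Rplus i2).
apply: ge0_le_integral.
- exact: measurable_Rplus.
- by move=> x _; rewrite lee_fin sqn_ge0.
- by apply/measurable_EFinP; exact: sqn_measurable.
- by have := measurable_int _ i2.
move=> x _ /=; rewrite -!EFinM -EFinD lee_fin /k /sqn /cRe /cIm !reimE.
set a := complex.Re (f x); set b := complex.Im (f x).
set c := complex.Re (g x); set d := complex.Im (g x).
set s := complex.Re z; set t := complex.Im z.
(* The difference of the two sides is [|f + z g|^2]. *)
rewrite -subr_ge0; set e := (X in 0 <= X).
have -> : e = (a + (s * c - t * d)) ^+ 2 + (b + (s * d + t * c)) ^+ 2 by rewrite /e; ring.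
by apply: addr_ge0; exact: sqr_ge0.
Qed.

Lemma norm2_ae f g : L2 f -> L2 g -> ae_on (@Rplus R) (fun x => f x = g x) ->
  norm2 f = norm2 g.
Proof.
move=> Lf Lg fg; rewrite /norm2 !sqn_EFin; congr (Num.sqrt (fine _)).
apply: ae_eq_integral.
- exact: measurable_Rplus.
- exact: measurable_int (L2_integrable Lf).
- exact: measurable_int (L2_integrable Lg).
by apply: ae_imp fg => x h /h /= E; rewrite /sqn /cRe /cIm E.
Qed.

End ComplexValued.

(** * Compactness of the resolvent *)

Section UniformBounds.
Variable R : realType.
Variable q : R -> R[i].

(** The bound is on [l(y)] and not on [l(y) - lam y], because the energy estimate uses [q = p^2] for
    the unshifted potential. *)
Definition bounded_sol (A : R) (y y1 y2 : R -> R[i]) : Prop :=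
  [/\ in_D q y y1 y2, norm2 y ^+ 2 <= A & norm2 (lexpr q y y2) ^+ 2 <= A].

(** Near 0 only local integrability of [q] is available, so the bootstrap runs on short windows
    [[x, x + h]] and is read off at the left end [x]. Working on [[0, N + 1]] leaves room for the
    window, as [h <= 1]. *)
Lemma local_bound (N A : R) : 0 <= N -> loc_int_from 0 q ->
  exists B : R, forall y y1 y2, bounded_sol A y y1 y2 ->
    forall x, 0 <= x <= N ->
    [/\ `|cRe y x| <= B, `|cIm y x| <= B, `|cRe y1 x| <= B & `|cIm y1 x| <= B].
Proof.
move=> N0 hq; have N1 : 0 <= N + 1 by lra.
have [iqr iqi] := hq _ N1; rewrite ccE in iqr iqi.
pose w x := `|cRe q x| + `|cIm q x|.
have iw : iint 0 (N + 1) w by apply: iintD; exact: iint_norm.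
pose Q := intg 0 (N + 1) w.
have w0 x : 0 <= w x by rewrite addr_ge0.
have Q0 : 0 <= Q by exact: intg_ge0.
(* Chosen so that [4 * h * Q = Q / (Q + 1) <= 1]; as [Q] is the integral over all of [[0, N + 1]],
   the same [h] serves every window. *)
pose h := (4 * (Q + 1))^-1.
have Q4 : 0 < 4 * (Q + 1) by lra.
have h0 : 0 < h by rewrite invr_gt0.
have h1 : h <= 1 by rewrite invf_le1 //; lra.
have hQ : 4 * h * Q <= 1.
  have -> : 4 * h * Q = Q / (Q + 1) by rewrite /h; field; rewrite gt_eqF //; lra.
  by rewrite ler_pdivrMr; lra.
pose kappa := 1 + 3 * A / h; pose G := 2 + A.
pose B := 28 * kappa + 4 * h * G.
pose C := 6 * kappa / h + (Q * B + G).
exists (B + C) => y y1 y2 [[hy hy1 Ly Lg] yA gA] x /andP[x0 xN].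
have xh : x <= x + h by lra.
have xhN : x + h <= N + 1 by lra.
have [acu acv] := AC_loc_ac hy x0 xh; have [acu1 acv1] := AC_loc_ac hy1 x0 xh.
have iwx : iint x (x + h) w by exact: iintS iw.
(* The right side is known in L2 only; [|t| <= 2 + t ^+ 2 + s ^+ 2] majorizes its real and imaginary
   parts by an integrable function of integral at most [2 + A] on a window. *)
pose gam x := 2 + sqn (lexpr q y y2) x.
have isx : iint x (x + h) (sqn (lexpr q y y2)) by exact: L2_iint.
have ig : iint x (x + h) gam by apply: iintD => //; exact: iint_cst.
have gG : intg x (x + h) gam <= G.
  rewrite intgD //; last exact: iint_cst.
  rewrite intg_cst // -[intg _ _ (fun=> _)]/(intg x (x + h) (sqn (lexpr q y y2))).
  have := intg_sqn_le (x + h) x0 Lg; rewrite /G; lra.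
have wQ : intg x (x + h) w <= Q by exact: intg_mono.
have yAx : intg x (x + h) (fun x => cRe y x ^+ 2 + cIm y x ^+ 2) <= A.
  exact: le_trans (intg_sqn_le (x + h) x0 Ly) yA.
have nb (t s : R) : `|t| <= 2 + (t ^+ 2 + s ^+ 2).
  rewrite -(real_normK (num_real t)); have := normr_ge0 t; set n := `|t|.
  by have := sqr_ge0 (n - 2^-1); have := sqr_ge0 s; rewrite sqrrB; nra.
have e2 z : y2 z = q z * y z - lexpr q y y2 z by rewrite /lexpr; ring.
have bu z : `|cRe y2 z| <= w z * (`|cRe y z| + `|cIm y z|) + gam z.
  have -> : cRe y2 z = cRe q z * cRe y z - cIm q z * cIm y z - cRe (lexpr q y y2) z.
    by rewrite /cRe /cIm {1}e2 !reimE.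
  apply: (le_trans (ler_normB _ _)); apply: lerD; last exact: nb.
  apply: (le_trans (ler_normB _ _)); rewrite !normrM /w.
  have := normr_ge0 (cRe q z); have := normr_ge0 (cIm q z).
  by have := normr_ge0 (cRe y z); have := normr_ge0 (cIm y z); nra.
have bv z : `|cIm y2 z| <= w z * (`|cRe y z| + `|cIm y z|) + gam z.
  have -> : cIm y2 z = cRe q z * cIm y z + cIm q z * cRe y z - cIm (lexpr q y y2) z.
    by rewrite /cRe /cIm {1}e2 !reimE.
  apply: (le_trans (ler_normB _ _)); apply: lerD; last first.
    by rewrite /gam /sqn addrC (addrC (_ ^+ 2)) addrC; exact: nb.
  apply: (le_trans (ler_normD _ _)); rewrite !normrM /w.
  have := normr_ge0 (cRe q z); have := normr_ge0 (cIm q z).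
  by have := normr_ge0 (cRe y z); have := normr_ge0 (cIm y z); nra.
have [bB bu1 bv1] := interval_bound h0 acu acv acu1 acv1 iwx ig (fun z _ => w0 z)
  (fun z _ => bu z) (fun z _ => bv z) wQ gG hQ yAx (introT andP (conj (lexx x) xh)).
rewrite -/kappa -/B -/C in bB bu1 bv1.
have B0 : 0 <= B by apply: le_trans bB; rewrite addr_ge0.
have C0 : 0 <= C by exact: le_trans bu1.
have := normr_ge0 (cRe y x); have := normr_ge0 (cIm y x) => *.
by split; lra.
Qed.

Lemma tail_bound (x0 A e : R) (p p1 : R -> R[i]) : 0 <= x0 -> 0 <= A ->
  is_sqrt_branch q p x0 -> AC_loc_with x0 p p1 -> rho_to_infty x0 p p1 -> 0 < e ->
  exists2 X : R, 0 <= X & forall y y1 y2, bounded_sol A y y1 y2 ->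
    forall N, X <= N -> intg X N (sqn y) <= e.
Proof.
(* Past the point where [rho >= M + 1], the energy estimate gives [M] times the tail at most
   [2 * A], and [M * e = e + 2 * A]. *)
move=> x00 A0 hp hac hrho e0; pose M := 1 + 2 * A / e.
have M1 : 1 <= M by rewrite lerDl divr_ge0 ?mulr_ge0 // ltW.
have [X [x0X hX]] := hrho (M + 1); have X0 := le_trans x00 x0X.
exists (X + 1); first by lra.
move=> y y1 y2 [[hy hy1 Ly Lg] yA gA] N XN.
have XN1 : X <= N + 1 by lra.
have [acu acv] := AC_loc_ac hy X0 XN1; have [acu1 acv1] := AC_loc_ac hy1 X0 XN1.
have [acpa acpb] := AC_loc_ac hac x0X XN1.
set g := lexpr q y y2 in gA Lg.
have e2 z : X <= z <= N + 1 -> y2 z = p z * p z * y z - g z.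
  move=> /andP[Xz _]; have [pq _] := hp z (le_trans x0X Xz).
  by rewrite /g /lexpr -pq expr2; ring.
have sol : schroedinger_sol X (N + 1) (cRe y) (cIm y) (cRe y1) (cIm y1)
    (cRe g) (cIm g) (cRe p) (cIm p).
  split=> //.
    by apply: ac_eq acu1 => z /e2 ez; rewrite /cRe /cIm ez !reimE; ring.
  by apply: ac_eq acv1 => z /e2 ez; rewrite /cRe /cIm ez !reimE; ring.
pose tau x := cabs (p1 x / p x).
have htau x : X <= x <= N + 1 ->
    tau x ^+ 2 * (cRe p x ^+ 2 + cIm p x ^+ 2) = cRe p1 x ^+ 2 + cIm p1 x ^+ 2.
  move=> /andP[Xx _]; have [_ p0] := hp x (le_trans x0X Xx).
  have pn0 : p x != 0.
    by apply/eqP => px; move: p0; rewrite px /= ltxx.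
  rewrite /tau cabs_sqr /cRe /cIm -[in RHS](divfK pn0 (p1 x)).
  by set w := p1 x / p x; rewrite !reimE; ring.
have MA := @energy_tail R X N (cRe y) (cIm y) (cRe y1) (cIm y1) (cRe g) (cIm g)
  (cRe p) (cIm p) (cRe p1) (cIm p1) tau (M + 1) A XN sol acpa acpb.
have {}MA : (M + 1 - 1) * intg (X + 1) N (sqn y) <= 2 * A.
  apply: MA => //.
  - by move=> x /andP[Xx _]; have [] := hp x (le_trans x0X Xx).
  - by move=> x _; rewrite /tau /cabs; case: (_ / _) => ? ?; exact: sqrtr_ge0.
  - apply: ae_imp hX => x hx /andP[Xx _].
    by have := hx Xx; rewrite /rho /cRe /tau /=; lra.
  - lra.
  - exact: L2_iint.
  - exact: le_trans (intg_sqn_le _ X0 Lg) gA.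
  - exact: le_trans (intg_sqn_le _ X0 Ly) yA.
have I0 : 0 <= intg (X + 1) N (sqn y) by apply: intg_ge0 => x _; exact: sqn_ge0.
have M0 : 0 < M by lra.
rewrite -(ler_pM2l M0); apply: (@le_trans _ _ (2 * A)); first by move: MA; rewrite addrK.
have -> : M * e = e + 2 * A by rewrite /M; field; rewrite gt_eqF.
lra.
Qed.

End UniformBounds.

Theorem theorem2 (R : realType) (q : R -> R[i]) (x0 : R) (a0 a1 : R[i])
    (p p1 : R -> R[i]) :
  0 <= x0 ->
  (a0 != 0) || (a1 != 0) ->
  is_sqrt_branch q p x0 ->
  AC_loc_with x0 p p1 ->
  condA q x0 p p1 ->
  rho_to_infty x0 p p1 ->
  forall lam : R[i], in_resolvent_set a0 a1 q lam ->
    resolvent_compact a0 a1 q lam.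
Proof.
move=> x00 _ hp hac [[hq _] _ _] hrho lam [_ _ [M0 hM0]] f y y1 y2 M hf hy.
have yD n : in_D q (y n) (y1 n) (y2 n) by have [[]] := hy n.
have Ly n : L2 (y n) by have [] := yD n.
have Lg n : L2 (lexpr q (y n) (y2 n)) by have [] := yD n.
have norm2_ge0 g : 0 <= norm2 g :> R by exact: sqrtr_ge0.
have fM n : norm2 (f n) ^+ 2 <= M ^+ 2.
  have [_ h] := hf n; have h0 := norm2_ge0 (f n).
  by rewrite ler_sqr ?nnegrE // (le_trans h0).
pose Ay := (M0 * M) ^+ 2.
have yA n : norm2 (y n) ^+ 2 <= Ay.
  have [yU yf] := hy n; have := hM0 _ _ _ yU.
  rewrite (norm2_ae (L2_lin lam (Lg n) (Ly n)) (hf n).1 yf) => h.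
  have : norm2 (y n) ^+ 2 <= (M0 * norm2 (f n)) ^+ 2.
    by rewrite ler_sqr ?nnegrE // (le_trans (norm2_ge0 (y n))).
  by move=> /le_trans; apply; rewrite /Ay !exprMn ler_wpM2l ?sqr_ge0.
(* From [l(y) = f + lam y], the squared norm of [l(y)] is at most [2 |f|^2 + k |y|^2]; [A] adds the
   bound [Ay] so as to dominate both quantities. *)
pose k := 2 * (complex.Re lam ^+ 2 + complex.Im lam ^+ 2).
have k0 : 0 <= k by rewrite mulr_ge0 ?addr_ge0 ?sqr_ge0.
pose A := Ay + (2 * M ^+ 2 + k * Ay).
have Ay0 : 0 <= Ay by exact: sqr_ge0.
have kA0 : 0 <= 2 * M ^+ 2 + k * Ay.
  by apply: addr_ge0; apply: mulr_ge0 => //; exact: sqr_ge0.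
have A0 : 0 <= A by exact: addr_ge0.
have bs n : bounded_sol q A (y n) (y1 n) (y2 n).
  split=> //; first by apply: (le_trans (yA n)); rewrite lerDl.
  have gle N : 0 <= N -> intg 0 N (sqn (lexpr q (y n) (y2 n))) <= A.
    move=> N0; have iy := L2_iint N (lexx 0) (Ly n).
    have if_ := L2_iint N (lexx 0) (hf n).1.
    apply: (@le_trans _ _ (intg 0 N (fun x => 2 * sqn (f n) x + k * sqn (y n) x))).
      apply: intg_ae_le; first exact: L2_iint.
        by apply: iintD; exact: iintZ.
      have [_ yf] := hy n; apply: ae_imp yf => x h /andP[x0' _].
      have {}h : lexpr q (y n) (y2 n) x = f n x + lam * y n x by rewrite -h // subrK.
      (* The difference of the two sides is [|f - lam y|^2]. *)
      rewrite /sqn /k /cRe /cIm h !reimE -subr_ge0.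
      set a := complex.Re (f n x); set b := complex.Im (f n x).
      set c := complex.Re (y n x); set d := complex.Im (y n x).
      set s := complex.Re lam; set t := complex.Im lam; set e := (X in 0 <= X).
      have -> : e = (a - (s * c - t * d)) ^+ 2 + (b - (s * d + t * c)) ^+ 2.
        by rewrite /e; ring.
      by apply: addr_ge0; exact: sqr_ge0.
    rewrite intgD; [|exact: iintZ|exact: iintZ]; rewrite !intgZ //.
    have h1 := le_trans (intg_sqn_le N (lexx 0) (hf n).1) (fM n).
    have h2 := le_trans (intg_sqn_le N (lexx 0) (Ly n)) (yA n).
    have : k * intg 0 N (sqn (y n)) <= k * Ay by exact: ler_wpM2l.
    by rewrite /A -!/(sqn _); move: h1; lra.
  have h := norm2_le A0 (fun N _ => L2_iint N (lexx 0) (Lg n)) gle.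
  rewrite -(sqr_sqrtr A0) ler_sqr ?nnegrE //; exact: sqrtr_ge0.
have cre n N : {within `[0, N], continuous (cRe (y n))} /\
    {within `[0, N], continuous (cIm (y n))}.
  have [N0|N0] := leP 0 N.
    have [hy0 _ _ _] := yD n; have [h1 h2] := AC_loc_ac hy0 (lexx 0) N0.
    by split; [exact: ac_cont h1 | exact: ac_cont h2].
  by rewrite set_itv_ge ?bnd_simp -?ltNge //; split; exact: continuous_subspace0.
have lb (N : R) : exists B : R, forall n x, 0 <= x <= N ->
    [/\ `|cRe (y n) x| <= B, `|cIm (y n) x| <= B, `|cRe (y1 n) x| <= B & `|cIm (y1 n) x| <= B].
  have [N0|N0] := leP 0 N.
    by have [B hB] := local_bound A N0 hq; exists B => n; exact: hB.
  by exists 0 => n x /andP[x1 x2]; have := le_trans x1 x2; rewrite leNgt N0.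
have bdd (N : R) : exists B : R, forall n (x : R), 0 <= x <= N ->
    `|cRe (y n) x| <= B /\ `|cIm (y n) x| <= B.
  by have [B hB] := lb N; exists B => n x /(hB n)[].
have lip (N : R) : exists B : R, forall n (x z : R), 0 <= x -> x <= z -> z <= N ->
    `|cRe (y n) z - cRe (y n) x| <= B * (z - x) /\
    `|cIm (y n) z - cIm (y n) x| <= B * (z - x).
  have [B hB] := lb N; exists B => n x z x0' xz zN.
  have z0 := le_trans x0' xz; have N0 := le_trans z0 zN.
  have [hy0 _ _ _] := yD n; have [h1 h2] := AC_loc_ac hy0 (lexx 0) N0.
  have b1 t : x <= t <= z -> `|cRe (y1 n) t| <= B /\ `|cIm (y1 n) t| <= B.
    move=> /andP[xt tz]; have [|] := hB n t; last by [].
    by rewrite (le_trans x0' xt) (le_trans tz zN).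
  rewrite (ac_sub h1) // (ac_sub h2) // -(intg_cst B xz).
  split; apply: intg_norm_le; try exact: iint_cst.
  - exact: iintS h1.1.
  - by move=> t /b1[].
  - exact: iintS h2.1.
  - by move=> t /b1[].
have tails (e : R) : 0 < e -> exists2 X : R, 0 <= X & forall n N, X <= N ->
    intg X N (fun x => cRe (y n) x ^+ 2 + cIm (y n) x ^+ 2) <= e.
  move=> e0; have [X X0 hX] := tail_bound x00 A0 hp hac hrho e0.
  by exists X => // n N; exact: hX (bs n) N.
have [phi [gr [gi [phi_inc cgr cgi hphi]]]] :=
  compact_subsequence (fun n N => (cre n N).1) (fun n N => (cre n N).2) bdd lip tails.
pose g x := Complex (gr x) (gi x).
pose d n (x : R) : R[i] := y (phi n) x - g x.
have Ed n : sqn (d n) = fun x =>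
    (cRe (y (phi n)) x - gr x) ^+ 2 + (cIm (y (phi n)) x - gi x) ^+ 2.
  by apply/funext => x; rewrite /sqn /d /cRe /cIm !reimE.
have id_ n N : iint 0 N (sqn (d n)).
  rewrite Ed; apply: iint_cont; have [h1 h2] := cre (phi n) N.
  by apply: cont_sqdist => //; exact: continuous_subspaceT.
have dle n N : 0 <= N -> intg 0 N (sqn (d n)) <= n.+1%:R^-1.
  by move=> N0; rewrite Ed; exact: hphi.
have ig N : iint 0 N (sqn g).
  apply: iint_cont; apply: within_continuousD.
    by have c := continuous_subspaceT (A := `[0, N]%classic) cgr; have := cont_mul c c.
  by have c := continuous_subspaceT (A := `[0, N]%classic) cgi; have := cont_mul c c.
exists phi, g; split => //.
  (* The limit is compared with the single function [y (phi 0)], at squared distance at most [1], by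
     [|g|^2 <= 2 |y|^2 + 2 |y - g|^2]; the slack in this inequality is [|g - 2 y|^2]. *)
  apply: (@L2_of_bounded _ _ (2 * A + 2)) => //.
  - by apply: measurable_funTS; exact: continuous_measurable_fun.
  - by apply: measurable_funTS; exact: continuous_measurable_fun.
  move=> N N0; have iy := L2_iint N (lexx 0) (Ly (phi 0%N)).
  apply: (@le_trans _ _ (intg 0 N (fun x => 2 * sqn (y (phi 0%N)) x + 2 * sqn (d 0%N) x))).
    apply: intg_le => //; first by apply: iintD; exact: iintZ.
    move=> x _; rewrite Ed /sqn -subr_ge0.
    set a := cRe (y _) x; set b := cIm (y _) x.
    have -> : cRe g x = gr x by []. have -> : cIm g x = gi x by [].
    set e := (X in 0 <= X).
    have -> : e = (gr x - 2 * a) ^+ 2 + (gi x - 2 * b) ^+ 2 by rewrite /e; ring.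
    by apply: addr_ge0; exact: sqr_ge0.
  rewrite intgD; [|exact: iintZ|exact: iintZ]; rewrite !intgZ //.
  have h1 := le_trans (intg_sqn_le N (lexx 0) (Ly (phi 0%N))) (yA (phi 0%N)).
  have := dle 0%N N N0; rewrite invr1; rewrite /A in kA0 *; lra.
apply: (@squeeze_cvgr _ _ _ _ (fun=> 0) (fun n => Num.sqrt n.+1%:R^-1)).
- apply: nearW => n; rewrite norm2_ge0 /=.
  by apply: (norm2_le _ (fun N _ => id_ n N) (dle n)); rewrite invr_ge0.
- exact: cvg_cst.
have h : Num.sqrt (n.+1%:R^-1 : R) @[n --> \oo] --> Num.sqrt (0 : R).
  by apply: (cvg_comp _ _ (@cvg_harmonic R)); exact: sqrt_continuous.
by rewrite sqrtr0 in h.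
Qed.
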